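(* Let $\mathcal{C}$ be a pivotal category with pivotal structure $\varrho:\mathrm{id}_{\mathcal{C}}\to{}^{\vee\vee}(-)$ and let $(P,Q)$ be a pivotal pair in $\mathcal{C}$. Suppose that $P$ is fixed by ${}^{\vee\vee}(-)$ (i.e. ${}^{\vee\vee}P=P$), ${}^{\vee}P=Q$ and $\varrho_P=\mathrm{id}_P$, where the duality morphisms of the pair $(P,Q)$ are the chosen ones, namely $\mathrm{ev}=\mathrm{ev}_P$, $\mathrm{coev}=\mathrm{coev}_P$, $\underline{\mathrm{ev}}=\mathrm{ev}_Q$ and $\underline{\mathrm{coev}}=\mathrm{coev}_Q$ (using ${}^{\vee}Q={}^{\vee\vee}P=P$). Then $\mathcal{C}(P,Q)$ is pivotal and the forgetful functor $U:\mathcal{C}(P,Q)\to\mathcal{C}$, $(X,\sigma)\mapsto X$, preserves this pivotal structure.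
   Context: Monoidal categories $(\mathcal{C},\otimes,\mathbf 1)$ are assumed strict; object names also denote identity morphisms. Duals: a left dual of $X$ is an object ${}^{\vee}X$ with $\mathrm{ev}_X:{}^{\vee}X\otimes X\to\mathbf 1$, $\mathrm{coev}_X:\mathbf 1\to X\otimes{}^{\vee}X$ satisfying the triangle identities; right duals are defined symmetrically. A category is rigid if all objects have left and right duals; duals are chosen. For $f:X\to Y$, ${}^{\vee}f=(\mathrm{ev}_Y\otimes{}^{\vee}X)({}^{\vee}Y\otimes f\otimes{}^{\vee}X)({}^{\vee}Y\otimes\mathrm{coev}_X)$. A pivotal category is a rigid monoidal category with a monoidal natural isomorphism $\varrho:\mathrm{id}\to{}^{\vee\vee}(-)$, called its pivotal structure. Preservation: for a strong monoidal functor $F$ between rigid categories, with structure isomorphisms $F_2(X,Y):F(X)\otimes F(Y)\to F(X\otimes Y)$, $F_0:\mathbf 1\to F(\mathbf 1)$, let $\zeta_X=(F_0^{-1}F(\mathrm{ev}_X)F_2({}^{\vee}X,X)\otimes{}^{\vee}F(X))(F({}^{\vee}X)\otimes\mathrm{coev}_{F(X)}):F({}^{\vee}X)\to{}^{\vee}F(X)$. If source and target have pivotal structures $\varrho,\varrho'$, then $F$ preserves the pivotal structure if $\varrho'_{F(X)}={}^{\vee}(\zeta_X^{-1})\,\zeta_{{}^{\vee}X}\,F(\varrho_X)$ for all $X$. A pivotal pair $(P,Q)$ in $\mathcal{C}$ consists of objects $P,Q$ with morphisms $\mathrm{coev}:\mathbf 1\to P\otimes Q$, $\mathrm{ev}:Q\otimes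 P\to\mathbf 1$ making $Q$ a left dual of $P$, and morphisms $\underline{\mathrm{coev}}:\mathbf 1\to Q\otimes P$, $\underline{\mathrm{ev}}:P\otimes Q\to\mathbf 1$ making $Q$ a right dual of $P$. The category $\mathcal{C}(P,Q)$: objects are pairs $(X,\sigma)$ with $X$ an object of $\mathcal{C}$ and $\sigma:X\otimes P\to P\otimes X$ an invertible morphism such that the two morphisms $$(\mathrm{ev}\otimes X\otimes Q)(Q\otimes\sigma\otimes Q)(Q\otimes X\otimes\mathrm{coev}):Q\otimes X\to X\otimes Q,$$ $$(Q\otimes X\otimes\underline{\mathrm{ev}})(Q\otimes\sigma^{-1}\otimes Q)(\underline{\mathrm{coev}}\otimes X\otimes Q):X\otimes Q\to Q\otimes X$$ are inverse to each other. Morphisms $(X,\sigma)\to(Y,\tau)$ are morphisms $f:X\to Y$ in $\mathcal{C}$ with $\tau(f\otimes P)=(P\otimes f)\sigma$. It is monoidal via $(X,\sigma)\otimes(Y,\tau)=(X\otimes Y,(\sigma\otimes Y)(X\otimes\tau))$ with unit $(\mathbf 1,\mathrm{id}_P)$, and $U$ is strict monoidal. When $\mathcal{C}$ is rigid so is $\mathcal{C}(P,Q)$, with duals whose underlying objects and duality morphisms are those of $\mathcal{C}$. *)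

(* Defs.v *)
From Corelib Require Import ssreflect ssrbool.
From Stdlib Require Import ClassicalEpsilon ProofIrrelevance.

Set Implicit Arguments.
Unset Strict Implicit.
Unset Printing Implicit Defensive.

Declare Scope ob_scope.
Declare Scope mor_scope.
Delimit Scope ob_scope with ob.
Delimit Scope mor_scope with mor.

(* Categories are given by a set of objects and a set of all morphisms, with
   domain and codomain maps, rather than by a family of hom-types.  In this
   style the strictness of a monoidal category, equalities of objects such as
   P^vv = P, and equations between morphisms depending on them are plain
   Leibniz equalities, without transports.  The composite [g ∘ f] is
   meaningful when [dom g = cod f]; nothing is assumed of it otherwise. *)
Record category := Category {
  Ob : Type;
  Mor : Type;
  dom : Mor -> Ob;
  cod : Mor -> Ob;
  idm : Ob -> Mor;
  comp : Mor -> Mor -> Mor;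
  dom_id : forall X, dom (idm X) = X;
  cod_id : forall X, cod (idm X) = X;
  dom_comp : forall g f, dom g = cod f -> dom (comp g f) = dom f;
  cod_comp : forall g f, dom g = cod f -> cod (comp g f) = cod g;
  comp_idl : forall f, comp (idm (cod f)) f = f;
  comp_idr : forall f, comp f (idm (dom f)) = f;
  comp_assoc : forall h g f, dom h = cod g -> dom g = cod f ->
    comp h (comp g f) = comp (comp h g) f
}.

Bind Scope ob_scope with Ob.
Bind Scope mor_scope with Mor.
Arguments idm {c} X%_ob.
Arguments comp {c} g%_mor f%_mor.
Arguments dom {c} f%_mor.
Arguments cod {c} f%_mor.

(* Object names also denote identity morphisms. *)
Coercion idm : Ob >-> Mor.

Notation "g ∘ f" := (comp g f) (at level 50, left associativity) : mor_scope.
Open Scope mor_scope.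

Definition hom (C : category) (X Y : Ob C) (f : Mor C) : Prop :=
  dom f = X /\ cod f = Y.
Arguments hom {C} X%_ob Y%_ob f%_mor.

Definition is_inverse (C : category) (f g : Mor C) : Prop :=
  hom (cod f) (dom f) g /\ g ∘ f = idm (dom f) /\ f ∘ g = idm (cod f).

Definition is_iso (C : category) (f : Mor C) : Prop :=
  exists g, is_inverse f g.

(* The inverse of [f]; meaningful when [f] is an isomorphism. *)
Definition inv (C : category) (f : Mor C) : Mor C :=
  epsilon (inhabits f) (is_inverse f).

Record monoidal := Monoidal {
  mcat :> category;
  unit : Ob mcat;
  tenso : Ob mcat -> Ob mcat -> Ob mcat;
  tensm : Mor mcat -> Mor mcat -> Mor mcat;
  dom_tens : forall f g, dom (tensm f g) = tenso (dom f) (dom g);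
  cod_tens : forall f g, cod (tensm f g) = tenso (cod f) (cod g);
  tens_id : forall X Y, tensm (idm X) (idm Y) = idm (tenso X Y);
  tens_comp : forall g f g' f', dom g = cod f -> dom g' = cod f' ->
    tensm (g ∘ f) (g' ∘ f') = tensm g g' ∘ tensm f f';
  tensoA : forall X Y Z, tenso X (tenso Y Z) = tenso (tenso X Y) Z;
  tenso1l : forall X, tenso unit X = X;
  tenso1r : forall X, tenso X unit = X;
  tensmA : forall f g h, tensm f (tensm g h) = tensm (tensm f g) h;
  tensm1l : forall f, tensm (idm unit) f = f;
  tensm1r : forall f, tensm f (idm unit) = f
}.

Arguments unit {m}.
Arguments tenso {m} X%_ob Y%_ob.
Arguments tensm {m} f%_mor g%_mor.

Notation "X ⊗ Y" := (tenso X Y) (at level 40, left associativity) : ob_scope.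
Notation "f ⊗ g" := (tensm f g) (at level 40, left associativity) : mor_scope.
Notation "𝟏" := unit : ob_scope.

(* [Y] is a left dual of [X]. *)
Definition is_left_dual (C : monoidal) (X Y : Ob C) (ev coev : Mor C) : Prop :=
  [/\ hom (Y ⊗ X) 𝟏 ev,
      hom 𝟏 (X ⊗ Y) coev,
      (X ⊗ ev) ∘ (coev ⊗ X) = X
    & (ev ⊗ Y) ∘ (Y ⊗ coev) = Y].

(* [Y] is a right dual of [X]. *)
Definition is_right_dual (C : monoidal) (X Y : Ob C) (ev coev : Mor C) : Prop :=
  [/\ hom (X ⊗ Y) 𝟏 ev,
      hom 𝟏 (Y ⊗ X) coev,
      (ev ⊗ X) ∘ (X ⊗ coev) = X
    & (Y ⊗ ev) ∘ (coev ⊗ Y) = Y].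

(* Rigidity of [C], with a choice of left and right duals. *)
Record rigid_structure (C : monoidal) := RigidStructure {
  ld : Ob C -> Ob C;
  ev : Ob C -> Mor C;
  coev : Ob C -> Mor C;
  ldP : forall X, is_left_dual X (ld X) (ev X) (coev X);
  rd : Ob C -> Ob C;
  ev_r : Ob C -> Mor C;
  coev_r : Ob C -> Mor C;
  rdP : forall X, is_right_dual X (rd X) (ev_r X) (coev_r X)
}.

Section LeftDuals.
Variables (C : monoidal) (D : rigid_structure C).

Definition ldm (f : Mor C) : Mor C :=
  let X := dom f in let Y := cod f in
  (ev D Y ⊗ ld D X) ∘ (ld D Y ⊗ f ⊗ ld D X) ∘ (ld D Y ⊗ coev D X).

(* The canonical isomorphisms vY ⊗ vX -> v(X ⊗ Y) and 1 -> v1. *)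
Definition ld2 (X Y : Ob C) : Mor C :=
  ((ev D Y ∘ (ld D Y ⊗ ev D X ⊗ Y)) ⊗ ld D (X ⊗ Y))
  ∘ (ld D Y ⊗ ld D X ⊗ coev D (X ⊗ Y)).
Definition ld0 : Mor C := coev D 𝟏.

(* The strong monoidal structure of the double dual functor:
   vvX ⊗ vvY -> v(vY ⊗ vX) -> vv(X ⊗ Y) and 1 -> v1 -> vv1. *)
Definition dd2 (X Y : Ob C) : Mor C :=
  ldm (inv (ld2 X Y)) ∘ ld2 (ld D Y) (ld D X).
Definition dd0 : Mor C := ldm (inv ld0) ∘ ld0.

Record pivotal_structure := PivotalStructure {
  piv : Ob C -> Mor C;
  piv_hom : forall X, hom X (ld D (ld D X)) (piv X);
  piv_iso : forall X, is_iso (piv X);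
  piv_nat : forall X Y f, hom X Y f -> piv Y ∘ f = ldm (ldm f) ∘ piv X;
  piv_tens : forall X Y, piv (X ⊗ Y)%ob = dd2 X Y ∘ (piv X ⊗ piv Y);
  piv_unit : piv 𝟏 = dd0
}.
End LeftDuals.

Record strong_monoidal_functor (C D : monoidal) := StrongMonoidalFunctor {
  Fob : Ob C -> Ob D;
  Fmor : Mor C -> Mor D;
  F2 : Ob C -> Ob C -> Mor D;
  F0 : Mor D;
  Fdom : forall f, dom (Fmor f) = Fob (dom f);
  Fcod : forall f, cod (Fmor f) = Fob (cod f);
  Fid : forall X, Fmor (idm X) = idm (Fob X);
  Fcomp : forall g f, dom g = cod f -> Fmor (g ∘ f) = Fmor g ∘ Fmor f;
  F2_hom : forall X Y, hom (Fob X ⊗ Fob Y) (Fob (X ⊗ Y)) (F2 X Y);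
  F2_iso : forall X Y, is_iso (F2 X Y);
  F2_nat : forall X Y X' Y' f g, hom X X' f -> hom Y Y' g ->
    F2 X' Y' ∘ (Fmor f ⊗ Fmor g) = Fmor (f ⊗ g) ∘ F2 X Y;
  F0_hom : hom 𝟏 (Fob 𝟏) F0;
  F0_iso : is_iso F0;
  F_assoc : forall X Y Z,
    F2 (X ⊗ Y)%ob Z ∘ (F2 X Y ⊗ Fob Z) = F2 X (Y ⊗ Z)%ob ∘ (Fob X ⊗ F2 Y Z);
  F_unitl : forall X, F2 𝟏 X ∘ (F0 ⊗ Fob X) = Fob X;
  F_unitr : forall X, F2 X 𝟏 ∘ (Fob X ⊗ F0) = Fob X
}.

Section Preservation.
Variables (C C' : monoidal) (F : strong_monoidal_functor C C').
Variables (D : rigid_structure C) (D' : rigid_structure C').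

Definition zeta (X : Ob C) : Mor C' :=
  ((inv (F0 F) ∘ Fmor F (ev D X) ∘ F2 F (ld D X) X) ⊗ ld D' (Fob F X))
  ∘ (Fob F (ld D X) ⊗ coev D' (Fob F X)).

Definition preserves_pivotal
    (rho : pivotal_structure D) (rho' : pivotal_structure D') : Prop :=
  forall X : Ob C,
    piv rho' (Fob F X) =
      ldm D' (inv (zeta X)) ∘ zeta (ld D X) ∘ Fmor F (piv rho X).
End Preservation.

Record pivotal_pair (C : monoidal) (P Q : Ob C) := PivotalPair {
  pp_ev : Mor C;
  pp_coev : Mor C;
  pp_uev : Mor C;
  pp_ucoev : Mor C;
  pp_left : is_left_dual P Q pp_ev pp_coev;
  pp_right : is_right_dual P Q pp_uev pp_ucoev
}.

Section CategoryLemmas.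
Variable C : category.
Implicit Types (X Y Z : Ob C) (f g h : Mor C).

Lemma hom_id X : hom X X X.
Proof. by split; rewrite ?dom_id ?cod_id. Qed.

Lemma hom_comp X Y Z f g : hom X Y f -> hom Y Z g -> hom X Z (g ∘ f).
Proof.
move=> [df cf] [dg cg]; have e : dom g = cod f by rewrite cf.
by split; rewrite ?(dom_comp e) ?(cod_comp e).
Qed.

Lemma hom_self f : hom (dom f) (cod f) f.
Proof. by []. Qed.

Lemma compIl X Y f : hom X Y f -> idm Y ∘ f = f.
Proof. by move=> [_ <-]; exact: comp_idl. Qed.

Lemma compIr X Y f : hom X Y f -> f ∘ idm X = f.
Proof. by move=> [<- _]; exact: comp_idr. Qed.

Lemma compA X Y Z W f g h : hom X Y f -> hom Y Z g -> hom Z W h ->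
  h ∘ (g ∘ f) = h ∘ g ∘ f.
Proof. by move=> [_ cf] [dg cg] [dh _]; apply: comp_assoc; congruence. Qed.

Lemma inverse_unique f g g' : is_inverse f g -> is_inverse f g' -> g = g'.
Proof.
move=> [hg [gf fg]] [hg' [gf' fg']].
rewrite -(compIr hg) -fg' (compA hg' (hom_self f) hg) gf.
exact: compIl hg'.
Qed.

Lemma invP f : is_iso f -> is_inverse f (inv f).
Proof. exact: epsilon_spec. Qed.

Lemma inv_eq f g : is_inverse f g -> inv f = g.
Proof. by move=> fg; apply: (inverse_unique (f := f)) => //; apply: invP; exists g. Qed.

Lemma inverse_comp X Y Z f g f' g' : hom X Y f -> hom Y Z g ->
  is_inverse f f' -> is_inverse g g' -> is_inverse (g ∘ f) (f' ∘ g').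
Proof.
move=> hf hg [hf' [f'f ff']] [hg' [g'g gg']].
case: (hf) (hg) => [df cf] [dg cg]; rewrite df cf in hf' f'f ff'.
rewrite dg cg in hg' g'g gg'.
have hgf := hom_comp hf hg; have hfg' := hom_comp hg' hf'.
case: (hgf) => dgf cgf; split; [|split]; rewrite ?dgf ?cgf //.
- by rewrite -(compA hgf hg' hf') (compA hf hg hg') g'g (compIl hf).
- by rewrite -(compA hfg' hf hg) (compA hg' hf' hf) ff' (compIl hg').
Qed.

Lemma inverse_id X : is_inverse (idm X) (idm X).
Proof.
split; [|split]; rewrite ?dom_id ?cod_id; first exact: hom_id.
all: exact: (compIl (hom_id X)).
Qed.
End CategoryLemmas.

Section MonoidalLemmas.
Variable C : monoidal.
Implicit Types (X Y Z : Ob C) (f g h : Mor C).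

Lemma hom_tens X Y X' Y' f g :
  hom X Y f -> hom X' Y' g -> hom (X ⊗ X') (Y ⊗ Y') (f ⊗ g).
Proof. by move=> [df cf] [dg cg]; split; rewrite ?dom_tens ?cod_tens; congruence. Qed.

Lemma tensC X Y X' Y' X'' Y'' f g f' g' :
  hom X X' f -> hom X' X'' g -> hom Y Y' f' -> hom Y' Y'' g' ->
  (g ∘ f) ⊗ (g' ∘ f') = (g ⊗ g') ∘ (f ⊗ f').
Proof. by move=> [_ ?] [? _] [_ ?] [? _]; apply: tens_comp; congruence. Qed.

Lemma whiskl Z X X' X'' f g : hom X X' f -> hom X' X'' g ->
  Z ⊗ (g ∘ f) = (Z ⊗ g) ∘ (Z ⊗ f).
Proof.
by move=> hf hg; rewrite -(tensC (hom_id Z) (hom_id Z) hf hg) (compIl (hom_id Z)).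
Qed.

Lemma whiskr Z X X' X'' f g : hom X X' f -> hom X' X'' g ->
  (g ∘ f) ⊗ Z = (g ⊗ Z) ∘ (f ⊗ Z).
Proof.
by move=> hf hg; rewrite -(tensC hf hg (hom_id Z) (hom_id Z)) (compIl (hom_id Z)).
Qed.

Lemma slide X X' Y Y' f g : hom X X' f -> hom Y Y' g ->
  (f ⊗ Y') ∘ (X ⊗ g) = (X' ⊗ g) ∘ (f ⊗ Y).
Proof.
move=> hf hg.
rewrite -(tensC (hom_id X) hf hg (hom_id Y')).
rewrite -(tensC hf (hom_id X') (hom_id Y) hg).
by rewrite (compIl hf) (compIr hf) (compIl hg) (compIr hg).
Qed.

Lemma inverse_tens f g f' g' :
  is_inverse f f' -> is_inverse g g' -> is_inverse (f ⊗ g) (f' ⊗ g').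
Proof.
move=> [hf [f1 f2]] [hg [g1 g2]]; split; [|split].
- by rewrite dom_tens cod_tens; exact: hom_tens.
- by rewrite -(tensC (hom_self f) hf (hom_self g) hg) f1 g1 tens_id dom_tens.
- by rewrite -(tensC hf (hom_self f) hg (hom_self g)) f2 g2 tens_id cod_tens.
Qed.
End MonoidalLemmas.

(* [dc] computes domains and codomains; [ms] puts identities and tensor
   products in strict normal form; [cl] associates composites to the left. *)
Ltac dc := rewrite ?dom_tens ?cod_tens ?dom_id ?cod_id;
  repeat first
  [ match goal with
    | H : dom ?f = _ |- context [dom ?f] => rewrite H
    | H : cod ?f = _ |- context [cod ?f] => rewrite H
    | |- context [dom (comp ?g ?f)] => rewrite (@dom_comp _ g f); [solve [dc]|]
    | |- context [cod (comp ?g ?f)] => rewrite (@cod_comp _ g f); [solve [dc]|]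
    end
  | rewrite dom_tens | rewrite cod_tens | rewrite dom_id | rewrite cod_id ];
  rewrite ?tensoA ?tenso1l ?tenso1r; try reflexivity.
Ltac solve_hom := solve [split; dc].
Ltac ms := rewrite -?tens_id ?tensmA ?tensm1l ?tensm1r.
Ltac cl := repeat (rewrite comp_assoc; [solve [dc]|solve [dc]|]).

Section PivotalPair.
Variables (C : monoidal) (P Q : Ob C) (PQ : pivotal_pair P Q).
Local Notation ev := (pp_ev PQ).
Local Notation coev := (pp_coev PQ).
Local Notation uev := (pp_uev PQ).
Local Notation ucoev := (pp_ucoev PQ).

(* The two morphisms Q ⊗ X -> X ⊗ Q and X ⊗ Q -> Q ⊗ X induced by
   s : X ⊗ P -> P ⊗ X and by t : P ⊗ X -> X ⊗ P, respectively. *)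
Definition bar (X : Ob C) (s : Mor C) : Mor C :=
  (ev ⊗ X ⊗ Q) ∘ (Q ⊗ s ⊗ Q) ∘ (Q ⊗ X ⊗ coev).
Definition ubar (X : Ob C) (t : Mor C) : Mor C :=
  (Q ⊗ X ⊗ uev) ∘ (Q ⊗ t ⊗ Q) ∘ (ucoev ⊗ X ⊗ Q).

Lemma bar_hom X s : hom (X ⊗ P) (P ⊗ X) s -> hom (Q ⊗ X) (X ⊗ Q) (bar X s).
Proof.
case: (pp_left PQ) => [[? ?] [? ?] _ _] [? ?]; rewrite /bar; solve_hom.
Qed.

Lemma ubar_hom X t : hom (P ⊗ X) (X ⊗ P) t -> hom (X ⊗ Q) (Q ⊗ X) (ubar X t).
Proof.
case: (pp_right PQ) => [[? ?] [? ?] _ _] [? ?]; rewrite /ubar; solve_hom.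
Qed.

Lemma tens_compl (Z : Ob C) (g f : Mor C) : dom g = cod f ->
  Z ⊗ (g ∘ f) = (Z ⊗ g) ∘ (Z ⊗ f).
Proof. by move=> e; exact: (@whiskl C Z _ _ _ f g (hom_self f) (conj e eq_refl)). Qed.

Lemma tens_compr (Z : Ob C) (g f : Mor C) : dom g = cod f ->
  (g ∘ f) ⊗ Z = (g ⊗ Z) ∘ (f ⊗ Z).
Proof. by move=> e; exact: (@whiskr C Z _ _ _ f g (hom_self f) (conj e eq_refl)). Qed.

Lemma slideE (f g : Mor C) : (f ⊗ cod g) ∘ (dom f ⊗ g) = (cod f ⊗ g) ∘ (f ⊗ dom g).
Proof. exact: slide. Qed.

Lemma bar_coev X s : hom (X ⊗ P) (P ⊗ X) s ->
  (P ⊗ bar X s) ∘ (coev ⊗ X) = (s ⊗ Q) ∘ (X ⊗ coev).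
Proof.
move=> [ds cs].
case: (pp_left PQ) => [[de ce] [dco cco] snake _].
rewrite /bar !tens_compl; try solve [dc].
have e1 := slideE coev (X ⊗ coev).
have e2 := slideE coev (s ⊗ Q).
move: e1 e2; dc; ms => e1 e2.
have -> : (P ⊗ ev ⊗ X ⊗ Q) ∘ (P ⊗ Q ⊗ s ⊗ Q) ∘ (P ⊗ Q ⊗ X ⊗ coev) ∘ (coev ⊗ X)
  = (P ⊗ ev ⊗ X ⊗ Q) ∘ (P ⊗ Q ⊗ s ⊗ Q) ∘ ((P ⊗ Q ⊗ X ⊗ coev) ∘ (coev ⊗ X)).
  by cl.
rewrite -e1; cl.
have -> : (P ⊗ ev ⊗ X ⊗ Q) ∘ (P ⊗ Q ⊗ s ⊗ Q) ∘ (coev ⊗ X ⊗ P ⊗ Q)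
  = (P ⊗ ev ⊗ X ⊗ Q) ∘ ((P ⊗ Q ⊗ s ⊗ Q) ∘ (coev ⊗ X ⊗ P ⊗ Q)).
  by cl.
rewrite -e2; cl.
have := f_equal (fun m => m ⊗ X ⊗ Q) snake.
rewrite !tens_compr; try solve [dc].
move=> ->.
congr (_ ∘ _).
ms; rewrite tens_id tens_id.
have h : hom (X ⊗ P ⊗ Q) (P ⊗ X ⊗ Q) (s ⊗ Q) by solve_hom.
exact: (compIl h).
Qed.

Lemma reassoc (l1 l2 r1 r2 : Mor C) : l1 ∘ l2 = r1 ∘ r2 ->
  dom l1 = cod l2 -> dom r1 = cod r2 -> forall a, dom a = cod l1 ->
  a ∘ l1 ∘ l2 = a ∘ r1 ∘ r2.
Proof.
move=> e el er a ea; rewrite -!comp_assoc ?e //.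
by rewrite -(cod_comp er) -e (cod_comp el).
Qed.

Lemma bar_tens X s Y t : hom (X ⊗ P) (P ⊗ X) s -> hom (Y ⊗ P) (P ⊗ Y) t ->
  bar (X ⊗ Y) ((s ⊗ Y) ∘ (X ⊗ t)) = (X ⊗ bar Y t) ∘ (bar X s ⊗ Y).
Proof.
move=> [ds cs] ht; case: (ht) => dt ct.
have [dB cB] := bar_hom ht; have e3 := f_equal (tensm (idm (Q ⊗ X))) (bar_coev ht).
case: (pp_left PQ) => [[de ce] [dco cco] _ _].
move: e3; rewrite [bar (X ⊗ Y)%ob _]/bar [bar X s]/bar; move: (bar Y t) dB cB => B dB cB.
do !(rewrite !tens_compl; try solve [dc]).
do !(rewrite !tens_compr; try solve [dc]).
have e1 := slideE (ev ⊗ X) B; have e2 := slideE (Q ⊗ s) B.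
move: e1 e2; dc; ms => e1 e2 e3; cl.
rewrite -e1 -(reassoc e2); try solve [dc].
by rewrite (reassoc e3); try solve [dc].
Qed.

Lemma ubar_ucoev X t : hom (P ⊗ X) (X ⊗ P) t ->
  (ubar X t ⊗ P) ∘ (X ⊗ ucoev) = (Q ⊗ t) ∘ (ucoev ⊗ X).
Proof.
move=> [dt ct].
case: (pp_right PQ) => [[de ce] [dco cco] snake _].
rewrite /ubar !tens_compr; try solve [dc].
have e1 := slideE (ucoev ⊗ X) ucoev.
have e2 := slideE (Q ⊗ t) ucoev.
have e3 := f_equal (tensm (idm (Q ⊗ X))) snake.
move: e1 e2 e3; rewrite tens_compl; try solve [dc].
dc; ms => e1 e2 e3.
rewrite (reassoc e1); try solve [dc].
rewrite (reassoc e2); try solve [dc].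
rewrite e3 !tens_id; congr (_ ∘ _).
have h : hom (Q ⊗ P ⊗ X) (Q ⊗ X ⊗ P) (Q ⊗ t) by solve_hom.
exact: (compIl h).
Qed.

Lemma ubar_tens X s Y t : hom (P ⊗ X) (X ⊗ P) s -> hom (P ⊗ Y) (Y ⊗ P) t ->
  ubar (X ⊗ Y) ((X ⊗ t) ∘ (s ⊗ Y)) = (ubar X s ⊗ Y) ∘ (X ⊗ ubar Y t).
Proof.
move=> hs [dt ct]; case: (hs) => ds cs.
have [dB cB] := ubar_hom hs.
have e3 := f_equal (fun m => m ⊗ Y ⊗ Q) (ubar_ucoev hs).
case: (pp_right PQ) => [[de ce] [dco cco] _ _].
move: e3; rewrite [ubar (X ⊗ Y)%ob _]/ubar [ubar Y t]/ubar; move: (ubar X s) dB cB => B dB cB.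
do !(rewrite !tens_compl; try solve [dc]).
do !(rewrite !tens_compr; try solve [dc]).
have e1 := slideE B (Y ⊗ uev); have e2 := slideE B (t ⊗ Q).
move: e1 e2; dc; ms => e1 e2 e3; cl.
rewrite e1 (reassoc e2); try solve [dc].
by rewrite (reassoc e3); try solve [dc].
Qed.

Lemma bar_unit : bar 𝟏 P = Q.
Proof.
case: (pp_left PQ) => [[de ce] [dco cco] _ snake].
rewrite /bar; ms; rewrite !tens_id.
rewrite -comp_assoc; [dc|dc|].
have h : hom Q (Q ⊗ P ⊗ Q) (Q ⊗ coev) by solve_hom.
by rewrite (compIl h).
Qed.

Lemma ubar_unit : ubar 𝟏 P = Q.
Proof.
case: (pp_right PQ) => [[de ce] [dco cco] _ snake].
rewrite /ubar; ms; rewrite !tens_id.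
rewrite -comp_assoc; [dc|dc|].
have h : hom Q (Q ⊗ P ⊗ Q) (ucoev ⊗ Q) by solve_hom.
by rewrite (compIl h).
Qed.

(* Objects and morphisms of C(P,Q). *)
Record cpq_ob := CpqOb {
  cob : Ob C;
  csig : Mor C;
  csig_hom : hom (cob ⊗ P) (P ⊗ cob) csig;
  csig_iso : is_iso csig;
  csig_bar : is_inverse (bar cob csig) (ubar cob (inv csig))
}.

Record cpq_mor := CpqMor {
  csrc : cpq_ob;
  ctgt : cpq_ob;
  cmor : Mor C;
  cmor_hom : hom (cob csrc) (cob ctgt) cmor;
  cmor_comm : csig ctgt ∘ (cmor ⊗ P) = (P ⊗ cmor) ∘ csig csrc
}.

Lemma cpq_ob_eq A B : cob A = cob B -> csig A = csig B -> A = B.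
Proof.
case: A B => [X s h i b] [X' s' h' i' b'] /= e e'; subst.
by congr CpqOb; exact: proof_irrelevance.
Qed.

Lemma cpq_mor_eq f g :
  csrc f = csrc g -> ctgt f = ctgt g -> cmor f = cmor g -> f = g.
Proof.
case: f g => [A B m h c] [A' B' m' h' c'] /= e e' e''; subst.
by congr CpqMor; exact: proof_irrelevance.
Qed.

Lemma cpq_idm_comm (A : cpq_ob) :
  csig A ∘ (cob A ⊗ P) = (P ⊗ cob A) ∘ csig A.
Proof. by have h := csig_hom A; rewrite !tens_id (compIr h) (compIl h). Qed.

Definition cpq_idm (A : cpq_ob) : cpq_mor :=
  CpqMor (hom_id (cob A)) (cpq_idm_comm A).

Lemma cpq_comp_hom (g f : cpq_mor) : csrc g = ctgt f ->
  hom (cob (csrc f)) (cob (ctgt g)) (cmor g ∘ cmor f).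
Proof.
by move=> e; apply: hom_comp (cmor_hom f) _; rewrite -e; exact: cmor_hom.
Qed.

Lemma cpq_comp_comm (g f : cpq_mor) : csrc g = ctgt f ->
  csig (ctgt g) ∘ ((cmor g ∘ cmor f) ⊗ P)
  = (P ⊗ (cmor g ∘ cmor f)) ∘ csig (csrc f).
Proof.
move=> e; have hf := cmor_hom f; have hg := cmor_hom g; rewrite e in hg.
case: (hf) (hg) (csig_hom (csrc f)) (csig_hom (ctgt f)) (csig_hom (ctgt g))
  => [? ?] [? ?] [? ?] [? ?] [? ?].
rewrite tens_compr ?tens_compl; try solve [dc].
cl; rewrite cmor_comm e -comp_assoc; [dc|dc|].
by rewrite cmor_comm; cl.
Qed.

Definition cpq_comp_on (g f : cpq_mor) (e : csrc g = ctgt f) : cpq_mor :=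
  CpqMor (cpq_comp_hom e) (cpq_comp_comm e).

(* Composites of non-composable morphisms are given the junk value [g]. *)
Definition cpq_comp (g f : cpq_mor) : cpq_mor :=
  match excluded_middle_informative (csrc g = ctgt f) with
  | left e => cpq_comp_on e
  | right _ => g
  end.

Lemma cpq_compE g f (e : csrc g = ctgt f) : cpq_comp g f = cpq_comp_on e.
Proof.
rewrite /cpq_comp; case: excluded_middle_informative => // e'.
by congr cpq_comp_on; exact: proof_irrelevance.
Qed.

Definition cpq_category : category.
Proof.
refine (@Category cpq_ob cpq_mor csrc ctgt cpq_idm cpq_comp _ _ _ _ _ _ _) => //.
- by move=> g f e; rewrite (cpq_compE e).
- by move=> g f e; rewrite (cpq_compE e).
- move=> f; have e : csrc (cpq_idm (ctgt f)) = ctgt f by [].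
  by rewrite (cpq_compE e); apply: cpq_mor_eq => //=; exact: compIl (cmor_hom f).
- move=> f; have e : csrc f = ctgt (cpq_idm (csrc f)) by [].
  by rewrite (cpq_compE e); apply: cpq_mor_eq => //=; exact: compIr (cmor_hom f).
- move=> h g f ehg egf; rewrite (cpq_compE ehg) (cpq_compE egf).
  have e : csrc h = ctgt (cpq_comp_on egf) by [].
  have e' : csrc (cpq_comp_on ehg) = ctgt f by [].
  rewrite (cpq_compE e) (cpq_compE e'); apply: cpq_mor_eq => //=.
  case: (cmor_hom f) (cmor_hom g) (cmor_hom h) => [_ cf] [dg cg] [dh _].
  by apply: comp_assoc; congruence.
Defined.

Lemma cpq_unit_hom : hom (𝟏 ⊗ P) (P ⊗ 𝟏) P.
Proof. by rewrite tenso1l tenso1r; exact: hom_id. Qed.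

Lemma cpq_unit_iso : is_iso (idm P).
Proof. by exists P; exact: inverse_id. Qed.

Lemma cpq_unit_bar : is_inverse (bar 𝟏 P) (ubar 𝟏 (inv (idm P))).
Proof.
by rewrite (inv_eq (inverse_id P)) bar_unit ubar_unit; exact: inverse_id.
Qed.

Definition cpq_unit : cpq_ob := CpqOb cpq_unit_hom cpq_unit_iso cpq_unit_bar.

Section Tensor.
Variables A B : cpq_ob.
Local Notation X := (cob A).
Local Notation Y := (cob B).

Definition cpq_sig : Mor C := (csig A ⊗ Y) ∘ (X ⊗ csig B).

Lemma cpq_sig_hom : hom (X ⊗ Y ⊗ P) (P ⊗ (X ⊗ Y)) cpq_sig.
Proof.
case: (csig_hom A) (csig_hom B) => [? ?] [? ?]; rewrite /cpq_sig; solve_hom.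
Qed.

Lemma cpq_sig_inv :
  is_inverse cpq_sig ((X ⊗ inv (csig B)) ∘ (inv (csig A) ⊗ Y)).
Proof.
case: (csig_hom A) (csig_hom B) => [dA cA] [dB cB].
apply: (inverse_comp (X := (X ⊗ Y ⊗ P)%ob) (Y := (X ⊗ P ⊗ Y)%ob)
  (Z := (P ⊗ X ⊗ Y)%ob)).
- solve_hom.
- solve_hom.
- by apply: inverse_tens; [exact: inverse_id|exact: invP (csig_iso B)].
- by apply: inverse_tens; [exact: invP (csig_iso A)|exact: inverse_id].
Qed.

Lemma cpq_sig_iso : is_iso cpq_sig.
Proof. by exists ((X ⊗ inv (csig B)) ∘ (inv (csig A) ⊗ Y)); exact: cpq_sig_inv. Qed.

Lemma cpq_sig_bar :
  is_inverse (bar (X ⊗ Y) cpq_sig) (ubar (X ⊗ Y) (inv cpq_sig)).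
Proof.
case: (csig_hom A) (csig_hom B) => [dA cA] [dB cB].
have [hA _] := invP (csig_iso A); have [hB _] := invP (csig_iso B).
rewrite dA cA in hA; rewrite dB cB in hB.
rewrite (inv_eq cpq_sig_inv) (bar_tens (csig_hom A) (csig_hom B)) (ubar_tens hA hB).
have [d1 c1] := bar_hom (csig_hom A); have [d2 c2] := bar_hom (csig_hom B).
apply: (inverse_comp (X := (Q ⊗ X ⊗ Y)%ob) (Y := (X ⊗ Q ⊗ Y)%ob)
  (Z := (X ⊗ Y ⊗ Q)%ob)).
- solve_hom.
- solve_hom.
- by apply: inverse_tens; [exact: csig_bar|exact: inverse_id].
- by apply: inverse_tens; [exact: inverse_id|exact: csig_bar].
Qed.

Definition cpq_tenso : cpq_ob := CpqOb cpq_sig_hom cpq_sig_iso cpq_sig_bar.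
End Tensor.

Lemma cpq_tensm_comm (f g : cpq_mor) :
  csig (cpq_tenso (ctgt f) (ctgt g)) ∘ (cmor f ⊗ cmor g ⊗ P)
  = (P ⊗ (cmor f ⊗ cmor g)) ∘ csig (cpq_tenso (csrc f) (csrc g)).
Proof.
rewrite /= /cpq_sig; case: (cmor_hom f) (cmor_hom g) => [df cf] [dg cg].
case: (csig_hom (csrc f)) (csig_hom (ctgt f)) => [? ?] [? ?].
case: (csig_hom (csrc g)) (csig_hom (ctgt g)) => [? ?] [? ?].
have -> : cmor f ⊗ cmor g = (cmor f ⊗ cob (ctgt g)) ∘ (cob (csrc f) ⊗ cmor g).
  rewrite -tens_comp ?dom_id ?cod_id //.
  by rewrite (compIr (cmor_hom f)) (compIl (cmor_hom g)).
have e1 := slideE (cmor f) (csig (ctgt g)).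
have e2 := slideE (csig (csrc f)) (cmor g).
have e3 := f_equal (fun m => m ⊗ cob (ctgt g)) (cmor_comm f).
have e4 := f_equal (fun m => cob (csrc f) ⊗ m) (cmor_comm g).
move: e1 e2 e3 e4; do !(rewrite !tens_compl; try solve [dc]).
do !(rewrite !tens_compr; try solve [dc]).
dc; ms => e1 e2 e3 e4; cl.
rewrite -(reassoc e1); try solve [dc].
rewrite e3 (reassoc e4); try solve [dc].
by rewrite (reassoc e2); try solve [dc].
Qed.

Definition cpq_tensm (f g : cpq_mor) : cpq_mor :=
  @CpqMor (cpq_tenso (csrc f) (csrc g)) (cpq_tenso (ctgt f) (ctgt g))
    (cmor f ⊗ cmor g) (hom_tens (cmor_hom f) (cmor_hom g)) (cpq_tensm_comm f g).

Lemma cpq_tensoA A B D :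
  cpq_tenso A (cpq_tenso B D) = cpq_tenso (cpq_tenso A B) D.
Proof.
case: (csig_hom A) (csig_hom B) (csig_hom D) => [? ?] [? ?] [? ?].
apply: cpq_ob_eq => /=; first exact: tensoA.
rewrite /cpq_sig /= /cpq_sig; do !(rewrite !tens_compl; try solve [dc]).
do !(rewrite !tens_compr; try solve [dc]).
by ms; cl.
Qed.

Lemma cpq_tenso1l A : cpq_tenso cpq_unit A = A.
Proof.
have h := csig_hom A; apply: cpq_ob_eq => /=; first exact: tenso1l.
by rewrite /cpq_sig /= tensm1l tens_id (compIl h).
Qed.

Lemma cpq_tenso1r A : cpq_tenso A cpq_unit = A.
Proof.
have h := csig_hom A; apply: cpq_ob_eq => /=; first exact: tenso1r.
by rewrite /cpq_sig /= tensm1r tens_id (compIr h).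
Qed.

Definition cpq : monoidal.
Proof.
refine (@Monoidal cpq_category cpq_unit cpq_tenso cpq_tensm
  _ _ _ _ cpq_tensoA cpq_tenso1l cpq_tenso1r _ _ _) => //.
- by move=> A B; apply: cpq_mor_eq => //=; exact: tens_id.
- move=> g f g' f' e e'.
  have e'' : csrc (cpq_tensm g g') = ctgt (cpq_tensm f f') by move: e e' => /= -> ->.
  rewrite /= (cpq_compE e) (cpq_compE e') (cpq_compE e'').
  apply: cpq_mor_eq => //=; apply: tens_comp.
  + by case: (cmor_hom g) (cmor_hom f) => [-> _] [_ ->]; rewrite (_ : csrc g = ctgt f).
  + by case: (cmor_hom g') (cmor_hom f') => [-> _] [_ ->]; rewrite (_ : csrc g' = ctgt f').
- by move=> f g h; apply: cpq_mor_eq => /=; [exact: cpq_tensoA..|exact: tensmA].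
- by move=> f; apply: cpq_mor_eq => /=; [exact: cpq_tenso1l..|exact: tensm1l].
- by move=> f; apply: cpq_mor_eq => /=; [exact: cpq_tenso1r..|exact: tensm1r].
Defined.

(* The forgetful functor U, strict monoidal. *)
Definition forgetful : strong_monoidal_functor cpq C.
Proof.
refine (@StrongMonoidalFunctor cpq C cob cmor
  (fun X Y => idm (cob X ⊗ cob Y)) (idm 𝟏) _ _ _ _ _ _ _ _ _ _ _ _) => //.
- by move=> f; case: (cmor_hom f).
- by move=> f; case: (cmor_hom f).
- by move=> g f e; rewrite /= (cpq_compE e).
- by move=> A B; exact: hom_id.
- by move=> A B; exists (idm (cob A ⊗ cob B)); exact: inverse_id.
- move=> A B A' B' f g [<- <-] [<- <-] /=.
  have h := hom_tens (cmor_hom f) (cmor_hom g).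
  by rewrite (compIl h) (compIr h).
- exact: hom_id.
- by exists (idm 𝟏); exact: inverse_id.
- by move=> A B D /=; rewrite !tens_id !tensoA.
- by move=> A /=; rewrite tens_id tenso1l; exact: (compIl (hom_id _)).
- by move=> A /=; rewrite tens_id tenso1r; exact: (compIl (hom_id _)).
Defined.
End PivotalPair.

(* The chosen duals of C(P,Q) are lifts of those of C along U. *)
Definition lifts_duals (C : monoidal) (P Q : Ob C) (PQ : pivotal_pair P Q)
    (D : rigid_structure C) (D' : rigid_structure (cpq PQ)) : Prop :=
  let U := forgetful PQ in
  forall A : Ob (cpq PQ),
    [/\ Fob U (ld D' A) = ld D (Fob U A),
        Fmor U (ev D' A) = ev D (Fob U A)
      & Fmor U (coev D' A) = coev D (Fob U A)] /\
    [/\ Fob U (rd D' A) = rd D (Fob U A),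
        Fmor U (ev_r D' A) = ev_r D (Fob U A)
      & Fmor U (coev_r D' A) = coev_r D (Fob U A)].

(* Main.v *)
From Corelib Require Import ssreflect ssrbool.
From Stdlib Require Import ProofIrrelevance.
Require Import Defs.

(** The left dual of (X, σ) in C(P,Q) carries the mate σ' of
      [ubar (σ^-1) : X ⊗ Q -> Q ⊗ X],
    formed with P as left dual of Q.  It is invertible because [bar σ] is
    inverse to [ubar (σ^-1)] and mates of inverses are inverse.  Straightening
    the loops hidden in [bar] and [ubar] shows that [bar σ'] is the mate of
    σ^-1 and [ubar (σ'^-1)] the mate of σ, now with Q as left dual of P
    ([bar_dual_sig], [ubar_dual_sig_inv]).  These are again inverse to each
    other, so (vX, σ') is an object of C(P,Q); and on repeating the
    construction the two formulas combine to say that the morphism σ'' carried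
    by vvX is the double mate of σ ([double_dual_sig]).

    Mates taken along tensor products of duals differ from the double dual
    functor by its monoidal structure only ([dd2_nat]), so σ'' is the conjugate
    of vvσ by [dd2].  Naturality of ϱ at σ, its monoidality and ϱ_P = id then say
    exactly that ϱ_X is a morphism from (X, σ) to (vvX, σ'')
    ([intertwines_piv]).  The axioms of a pivotal structure and its
    preservation can be tested after applying U, which is strict and faithful
    and matches the chosen left duals, so that ζ is the identity.

    Right duals are obtained from left ones.  Precomposing the evaluation of vX
    with ϱ_X makes vX a right dual of X, hence isomorphic to the chosen right dual
    by an isomorphism compatible with evaluations and coevaluations;
    transporting σ' along it puts the chosen right dual of X into C(P,Q)
    together with its duality morphisms ([intertwines_ev_r],
    [intertwines_coev_r]). *)

Set Implicit Arguments.
Unset Strict Implicit.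
Unset Printing Implicit Defensive.

(** * Composition and inverses *)

(* Distributes whiskering over composites, as far as composability is visible. *)
Ltac expand := do ?(rewrite !tens_compl; try solve [dc]);
  do ?(rewrite !tens_compr; try solve [dc]).

Lemma reassoc_id (C : category) (l r a : Mor C) (X : Ob C) : l ∘ r = idm X ->
  dom l = cod r -> dom a = cod l -> a ∘ l ∘ r = a.
Proof.
move=> e el ea; rewrite -comp_assoc // e.
by rewrite -(cod_id X) -e (cod_comp el) -ea comp_idr.
Qed.

Lemma comp_id_dom (C : category) (f : Mor C) (X : Ob C) : dom f = X -> f ∘ X = f.
Proof. by move=> <-; exact: comp_idr. Qed.

Lemma comp_id_cod (C : category) (f : Mor C) (X : Ob C) : cod f = X -> idm X ∘ f = f.
Proof. by move=> <-; exact: comp_idl. Qed.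

Lemma is_inverse_sym (C : category) (f g : Mor C) : is_inverse f g -> is_inverse g f.
Proof. by move=> [[dg cg] [gf fg]]; split; [|split]; rewrite ?dg ?cg. Qed.

Lemma inverse_hom (C : category) (f g : Mor C) (X1 X2 : Ob C) :
  hom X1 X2 f -> is_inverse f g -> hom X2 X1 g.
Proof. by move=> [<- <-] []. Qed.

Lemma is_iso_cancel (C : category) (X Y Z : Ob C) (f g k : Mor C) :
  is_iso k -> hom Y Z k -> hom X Y f -> hom X Y g -> k ∘ f = k ∘ g -> f = g.
Proof.
move=> [k' kk'] hk hf hg E; have hk' := inverse_hom hk kk'.
have [_ [e _]] := kk'.
rewrite -(compIl hf) -(compIl hg); have [dk _] := hk; rewrite -dk -e.
by rewrite -(compA hf hk hk') -(compA hg hk hk') E.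
Qed.

(** * Left duals and mates *)

Section Duality.
Variable C : monoidal.
Implicit Types (X Y Z W : Ob C) (f g h : Mor C).

(** Left duals other than the chosen ones are needed throughout: those of the
    pair (P, Q) and those of tensor products. *)
Record duality X := Duality {
  dobj : Ob C;
  dev : Mor C;
  dcoev : Mor C;
  dualityP : is_left_dual X dobj dev dcoev
}.

Lemma duality_eq X (a b : duality X) :
  dobj a = dobj b -> dev a = dev b -> dcoev a = dcoev b -> a = b.
Proof.
case: a b => [X' e c p] [X'' e' c' p'] /= ? ? ?; subst.
by congr Duality; exact: proof_irrelevance.
Qed.

(** Morphisms into a left dual are determined by their pairing with the
    evaluation, since the coevaluation recovers them; most identities below are
    proved by this principle.  The factor [W] is a bystander. *)
Lemma cancel_ev X (a : duality X) Z W g h :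
  hom Z (W ⊗ dobj a) g -> hom Z (W ⊗ dobj a) h ->
  (W ⊗ dev a) ∘ (g ⊗ X) = (W ⊗ dev a) ∘ (h ⊗ X) -> g = h.
Proof.
case: a => X' e c /= [[de ce] [dc0 cc0] _ snake].
suff rebuild k : hom Z (W ⊗ X') k ->
    k = (((W ⊗ e) ∘ (k ⊗ X)) ⊗ X') ∘ (Z ⊗ c).
  by move=> hg hh E; rewrite (rebuild g hg) (rebuild h hh) E.
move=> hk; case: (hk) => dk ck.
have e1 := slideE k c; have e2 := f_equal (tensm (idm W)) snake.
move: e1 e2; expand; dc; ms => e1 e2.
rewrite -comp_assoc; [dc|dc|].
rewrite e1; cl; rewrite e2 tens_id.
by rewrite (compIl hk).
Qed.

(** The mirror image: the left dual has the original object as a right dual. *)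
Lemma cancel_ev_left X (a : duality X) Z W g h :
  hom Z (X ⊗ W) g -> hom Z (X ⊗ W) h ->
  (dev a ⊗ W) ∘ (dobj a ⊗ g) = (dev a ⊗ W) ∘ (dobj a ⊗ h) -> g = h.
Proof.
case: a => X' e c /= [[de ce] [dc0 cc0] snake _].
suff rebuild k : hom Z (X ⊗ W) k ->
    k = (X ⊗ ((e ⊗ W) ∘ (X' ⊗ k))) ∘ (c ⊗ Z).
  by move=> hg hh E; rewrite (rebuild g hg) (rebuild h hh) E.
move=> hk; case: (hk) => dk ck.
have e1 := slideE c k; have e2 := f_equal (fun m => m ⊗ W) snake.
move: e1 e2; expand; dc; ms => e1 e2.
rewrite -comp_assoc; [dc|dc|].
rewrite -e1; cl; rewrite e2 tens_id.
by rewrite (compIl hk).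
Qed.

(** The left dual of [f], for arbitrary left duals of its source and target. *)
Definition mate X Y (a : duality X) (b : duality Y) f : Mor C :=
  (dev b ⊗ dobj a) ∘ (dobj b ⊗ f ⊗ dobj a) ∘ (dobj b ⊗ dcoev a).

Lemma mate_hom X Y (a : duality X) (b : duality Y) f :
  hom X Y f -> hom (dobj b) (dobj a) (mate a b f).
Proof.
move=> [? ?]; rewrite /mate.
case: (dualityP a) (dualityP b) => [[? ?] [? ?] _ _] [[? ?] [? ?] _ _].
solve_hom.
Qed.

(** With [mate_unique], the universal property that replaces computations with
    the coevaluation. *)
Lemma mate_ev X Y (a : duality X) (b : duality Y) f : hom X Y f ->
  dev a ∘ (mate a b f ⊗ X) = dev b ∘ (dobj b ⊗ f).
Proof.
move=> [df cf]; rewrite /mate.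
case: (dualityP a) (dualityP b) => [[? ?] [? ?] snake _] [[? ?] [? ?] _ _].
have e1 := slideE (dev b) (dev a).
have e2 := slideE (dobj b ⊗ f) (dev a).
have e3 := f_equal (tensm (idm (dobj b))) snake.
move: e1 e2 e3; expand; dc; ms => e1 e2 e3; cl.
rewrite -e1 -(reassoc e2); try solve [dc].
rewrite -comp_assoc; [dc|dc|].
rewrite e3 !tens_id.
have hf : hom (dobj b ⊗ X) (dobj b ⊗ Y) (dobj b ⊗ f) by solve_hom.
rewrite -comp_assoc; [dc|dc|].
by rewrite (compIr hf).
Qed.

Lemma mate_unique X Y (a : duality X) (b : duality Y) f k :
  hom X Y f -> hom (dobj b) (dobj a) k ->
  dev a ∘ (k ⊗ X) = dev b ∘ (dobj b ⊗ f) -> k = mate a b f.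
Proof.
move=> hf hk E; apply: (@cancel_ev X a (dobj b) 𝟏).
- by rewrite tenso1l.
- by rewrite tenso1l; exact: mate_hom.
- by rewrite tensm1l mate_ev.
Qed.

Lemma mate_id X (a : duality X) : mate a a X = dobj a.
Proof.
symmetry; apply: mate_unique; [exact: hom_id|exact: hom_id|].
by rewrite !tens_id.
Qed.

(** Taking one of the arrows to be an identity, this also compares mates along
    different choices of duals. *)
Lemma mate_comp X Y Z (a : duality X) (b : duality Y) (d : duality Z) f g :
  hom X Y f -> hom Y Z g -> mate a d (g ∘ f) = mate a b f ∘ mate b d g.
Proof.
move=> hf hg; have hgf := hom_comp hf hg.
have hmf := mate_hom a b hf; have hmg := mate_hom b d hg.
symmetry; apply: mate_unique => //; first exact: hom_comp hmg hmf.
have e1 := mate_ev a b hf; have e2 := mate_ev b d hg.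
move: (mate a b f) (mate b d g) hmf hmg e1 e2 => m n [? ?] [? ?] e1 e2.
case: (hf) (hg) => [? ?] [? ?].
case: (dualityP a) (dualityP b) (dualityP d)
  => [[? ?] [? ?] _ _] [[? ?] [? ?] _ _] [[? ?] [? ?] _ _].
have e3 := slideE n f; move: e3; expand; dc => e3; cl.
rewrite e1 -comp_assoc; [dc|dc|].
by rewrite -e3; cl; rewrite e2.
Qed.

Lemma mate_inverse X Y (a : duality X) (b : duality Y) f f' :
  hom X Y f -> is_inverse f f' -> is_inverse (mate a b f) (mate b a f').
Proof.
move=> hf [hf' [f'f ff']]; case: (hf) => df cf.
rewrite df cf in hf' f'f ff'.
have hm := mate_hom a b hf; case: (hm) => dm cm.
split; [|split]; rewrite ?dm ?cm; first exact: mate_hom.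
- by rewrite -(mate_comp b a b hf' hf) ff' mate_id.
- by rewrite -(mate_comp a b a hf hf') f'f mate_id.
Qed.

Lemma dual_tensP X Y (a : duality X) (b : duality Y) :
  is_left_dual (X ⊗ Y) (dobj b ⊗ dobj a)
    (dev b ∘ (dobj b ⊗ dev a ⊗ Y)) ((X ⊗ dcoev b ⊗ dobj a) ∘ dcoev a).
Proof.
case: a b => [X' e c [[? ?] [? ?] s1 s2]] [Y' e' c' [[? ?] [? ?] s1' s2']] /=.
split; [solve_hom|solve_hom| |].
- have e1 := slideE c' e.
  have e2 := f_equal (fun m => m ⊗ Y) s1.
  have e3 := f_equal (tensm (idm X)) s1'.
  move: e1 e2 e3; expand; dc; ms => e1 e2 e3; cl.
  have e4 := f_equal (fun m => X ⊗ m ⊗ Y) e1.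
  move: e4; expand; dc; ms => e4.
  rewrite -(reassoc e4); try solve [dc].
  rewrite e3 -comp_assoc; [dc|dc|].
  rewrite e2 !tens_id; exact: (compIl (hom_id _)).
- have e1 := slideE e c'.
  have e2 := f_equal (fun m => m ⊗ X') s2'.
  have e3 := f_equal (tensm (idm Y')) s2.
  move: e1 e2 e3; expand; dc; ms => e1 e2 e3; cl.
  have e4 := f_equal (fun m => Y' ⊗ m ⊗ X') e1.
  move: e4; expand; dc; ms => e4.
  rewrite (reassoc e4); try solve [dc].
  rewrite e2 -comp_assoc; [dc|dc|].
  rewrite e3 !tens_id; exact: (compIl (hom_id _)).
Qed.

Definition dual_tens X Y (a : duality X) (b : duality Y) : duality (X ⊗ Y) :=
  Duality (dual_tensP a b).
End Duality.

(** * Half-braidings on left duals *)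

Section Pair.
Variables (C : monoidal) (P Q : Ob C) (PQ : pivotal_pair P Q).
Local Notation ev := (pp_ev PQ).
Local Notation coev := (pp_coev PQ).
Local Notation uev := (pp_uev PQ).
Local Notation ucoev := (pp_ucoev PQ).

Definition pair_dualP : duality P := Duality (pp_left PQ).

Lemma pair_right_left : is_left_dual Q P uev ucoev.
Proof. by case: (pp_right PQ). Qed.

Definition pair_dualQ : duality Q := Duality pair_right_left.

(** The evaluation counterpart of [bar_coev]: [bar] bends the strand of P
    around, and the snake identity straightens it. *)
Lemma bar_ev X s : hom (X ⊗ P) (P ⊗ X) s ->
  (X ⊗ ev) ∘ (bar PQ X s ⊗ P) = (ev ⊗ X) ∘ (Q ⊗ s).
Proof.
move=> [ds cs].
case: (pp_left PQ) => [[de ce] [dco cco] snake _].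
rewrite /bar; have e1 := slideE (ev ⊗ X) ev.
have e2 := slideE (Q ⊗ s) ev.
have e3 := f_equal (tensm (idm (Q ⊗ X))) snake.
move: e1 e2 e3; expand; dc; ms => e1 e2 e3; cl.
rewrite -e1 -(reassoc e2); try solve [dc].
rewrite -comp_assoc; [dc|dc|].
rewrite e3 !tens_id.
have h : hom (Q ⊗ X ⊗ P) (Q ⊗ P ⊗ X) (Q ⊗ s) by solve_hom.
rewrite -comp_assoc; [dc|dc|].
by rewrite (compIr h).
Qed.

Lemma ubar_uev X t : hom (P ⊗ X) (X ⊗ P) t ->
  (uev ⊗ X) ∘ (P ⊗ ubar PQ X t) = (X ⊗ uev) ∘ (t ⊗ Q).
Proof.
move=> [dt ct].
case: (pp_right PQ) => [[de ce] [dco cco] snake _].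
rewrite /ubar; have e1 := slideE uev (X ⊗ uev).
have e2 := slideE uev (t ⊗ Q).
have e3 := f_equal (fun m => m ⊗ X ⊗ Q) snake.
move: e1 e2 e3; expand; dc; ms => e1 e2 e3; cl.
rewrite e1 (reassoc e2); try solve [dc].
rewrite -comp_assoc; [dc|dc|].
rewrite e3 !tens_id.
have h : hom (P ⊗ X ⊗ Q) (X ⊗ P ⊗ Q) (t ⊗ Q) by solve_hom.
rewrite -comp_assoc; [dc|dc|].
by rewrite (compIr h).
Qed.

Section DualObject.
Variables (A : cpq_ob PQ) (a : duality (cob A)).
Local Notation X := (cob A).
Local Notation X' := (dobj a).
Local Notation s := (csig A).
Local Notation t := (inv (csig A)).

Lemma csig_inv_hom : hom (P ⊗ X) (X ⊗ P) t.
Proof.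
by have [h _] := invP (csig_iso A); case: (csig_hom A) h => -> ->.
Qed.

(** One could take the mate of [t] along [X] alone; writing it as the mate of
    [ubar t] makes invertibility immediate, and [dual_sig_ev] shows that the two
    agree. *)
Definition dual_sig : Mor C :=
  mate (dual_tens a pair_dualQ) (dual_tens pair_dualQ a) (ubar PQ X t).

Definition dual_sig_inv : Mor C :=
  mate (dual_tens pair_dualQ a) (dual_tens a pair_dualQ) (bar PQ X s).

Lemma dual_sig_hom : hom (X' ⊗ P) (P ⊗ X') dual_sig.
Proof. exact: mate_hom (ubar_hom PQ csig_inv_hom). Qed.

Lemma dual_sig_inv_hom : hom (P ⊗ X') (X' ⊗ P) dual_sig_inv.
Proof. exact: mate_hom (bar_hom PQ (csig_hom A)). Qed.

Lemma dual_sigP : is_inverse dual_sig dual_sig_inv.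
Proof.
apply: mate_inverse (ubar_hom PQ csig_inv_hom) _.
exact: is_inverse_sym (csig_bar A).
Qed.

(** Evaluating the strand of P against Q by [uev] turns both sides into the
    universal property of the mate, as [ubar_uev] undoes [ubar]. *)
Lemma dual_sig_ev : (P ⊗ dev a) ∘ (dual_sig ⊗ X) = (dev a ⊗ P) ∘ (X' ⊗ t).
Proof.
have E := mate_ev (dual_tens a pair_dualQ) (dual_tens pair_dualQ a)
  (ubar_hom PQ csig_inv_hom).
have hS := dual_sig_hom; rewrite -/dual_sig in E.
move: dual_sig hS E => S [dS cS].
have ht := csig_inv_hom; have [dt ct] := ht; have E1 := ubar_uev ht.
have [du cu] := ubar_hom PQ ht.
move: (ubar PQ X t) du cu E1 => u du cu E1.
case: (dualityP a) => [[de ce] [dco cco] _ _].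
case: (pp_right PQ) => [[due cue] [duco cuco] _ _].
move=> /= E.
apply: (@cancel_ev C Q pair_dualQ (X' ⊗ P ⊗ X) 𝟏) => /=; [solve_hom|solve_hom|].
have E2 := f_equal (fun m => dev a ∘ (X' ⊗ m)) E1.
have e1 := slideE (dev a) uev.
move: E E2 e1; expand; dc; ms => E E2 e1; cl.
move: E E2; cl => E E2.
by rewrite E E2 -e1.
Qed.

(** Here the evaluation hidden in [ubar] is removed against the dual of [Q], so
    that only the mate of [bar] along [X] remains. *)
Lemma dual_sig_inv_ev :
  (Q ⊗ dev a) ∘ (ubar PQ X' dual_sig_inv ⊗ X) = (dev a ⊗ Q) ∘ (X' ⊗ bar PQ X s).
Proof.
have E := mate_ev (dual_tens pair_dualQ a) (dual_tens a pair_dualQ)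
  (bar_hom PQ (csig_hom A)).
have hS := dual_sig_inv_hom; rewrite -/dual_sig_inv in E.
move: dual_sig_inv hS E => S hS; have [dS cS] := hS.
have E1 := ubar_uev hS.
have [du cu] := ubar_hom PQ hS.
move: (ubar PQ X' S) du cu E1 => u du cu E1.
have [db cb] := bar_hom PQ (csig_hom A).
move: (bar PQ X s) db cb => b db cb.
case: (dualityP a) => [[de ce] [dco cco] _ _].
case: (pp_right PQ) => [[due cue] [duco cuco] _ _].
move=> /= E.
apply: (@cancel_ev_left C Q pair_dualQ (X' ⊗ Q ⊗ X) 𝟏) => /=; [solve_hom|solve_hom|].
have E2 := f_equal (fun m => dev a ∘ (m ⊗ X)) E1.
have e1 := slideE uev (dev a).
move: E E2 e1; expand; dc; ms => E E2 e1; cl.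
move: E E2; cl => E E2.
by rewrite e1 E2 E.
Qed.

(** [bar] forms a mate along P and [dual_sig] amounts to a mate along [X]; in
    succession they give the mate along the tensor product. *)
Lemma bar_dual_sig :
  bar PQ X' dual_sig = mate (dual_tens pair_dualP a) (dual_tens a pair_dualP) t.
Proof.
have ht := csig_inv_hom; have hS := dual_sig_hom; have E := dual_sig_ev.
move: dual_sig hS E => S hS E.
have hb := bar_hom PQ hS; have E1 := bar_ev hS.
move: (bar PQ X' S) hb E1 => b hb E1.
apply: mate_unique => //=.
have [dt ct] := ht; have [dS cS] := hS; have [db cb] := hb.
case: (dualityP a) => [[de ce] [dco cco] _ _].
case: (pp_left PQ) => [[due cue] [duco cuco] _ _].
have E2 := f_equal (fun m => dev a ∘ (m ⊗ X)) E1.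
have E3 := f_equal (fun m => ev ∘ (Q ⊗ m)) E.
have e1 := slideE ev (dev a).
move: E2 E3 e1; expand; dc; ms => E2 E3 e1; move: E2 E3; cl => E2 E3.
by rewrite E2 -e1 E3.
Qed.

(** The loop made of [uev] and [ucoev] cancels, and what survives is the mate
    along P, by [ev] and [coev], inside [bar]. *)
Lemma ubar_dual_sig_inv :
  ubar PQ X' dual_sig_inv
  = mate (dual_tens a pair_dualP) (dual_tens pair_dualP a) s.
Proof.
have hs := csig_hom A; have E := dual_sig_inv_ev.
have hu := ubar_hom PQ dual_sig_inv_hom.
move: (ubar PQ X' dual_sig_inv) hu E => u hu.
have hb := bar_hom PQ hs; have E1 := bar_ev hs.
move: (bar PQ X s) hb E1 => b hb E1 E.
apply: mate_unique => //=.
have [ds cs] := hs; have [du cu] := hu; have [db cb] := hb.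
case: (dualityP a) => [[de ce] [dco cco] _ _].
case: (pp_left PQ) => [[due cue] [duco cuco] _ _].
have E2 := f_equal (fun m => dev a ∘ (X' ⊗ m)) E1.
have E3 := f_equal (fun m => ev ∘ (m ⊗ P)) E.
have e1 := slideE (dev a) ev.
move: E2 E3 e1; expand; dc; ms => E2 E3 e1; move: E2 E3; cl => E2 E3.
by rewrite E3 -e1 E2.
Qed.

Lemma dual_sig_iso : is_iso dual_sig.
Proof. by exists dual_sig_inv; exact: dual_sigP. Qed.

Lemma inv_dual_sig : inv dual_sig = dual_sig_inv.
Proof. exact: inv_eq dual_sigP. Qed.

Lemma dual_sig_bar :
  is_inverse (bar PQ X' dual_sig) (ubar PQ X' (inv dual_sig)).
Proof.
rewrite inv_dual_sig bar_dual_sig ubar_dual_sig_inv.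
apply: mate_inverse csig_inv_hom _.
exact: is_inverse_sym (invP (csig_iso A)).
Qed.

Definition cpq_dual : cpq_ob PQ := CpqOb dual_sig_hom dual_sig_iso dual_sig_bar.

(** This is [dual_sig_ev], once [t] cancels against the half-braiding of [A]. *)
Lemma cpq_ev_comm :
  csig (cpq_unit PQ) ∘ (dev a ⊗ P)
  = (P ⊗ dev a) ∘ csig (cpq_tenso cpq_dual A).
Proof.
rewrite /= /cpq_sig /=.
have [ds cs] := csig_hom A; have [dt ct] := csig_inv_hom.
have [_ [ts _]] := invP (csig_iso A); have E := dual_sig_ev.
have [dS cS] := dual_sig_hom; move: dual_sig dS cS E => S dS cS E.
case: (dualityP a) => [[de ce] [dco cco] _ _].
have e := f_equal (tensm (idm X')) ts.
move: e; expand; dc => e; cl.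
rewrite E -comp_assoc; [dc|dc|].
rewrite e; ms; rewrite !tens_id.
have h : hom (X' ⊗ X ⊗ P) P (dev a ⊗ P) by solve_hom.
by rewrite (compIl h) (compIr h).
Qed.

(** Compatibility with the coevaluation follows from compatibility with the
    evaluation: pair both sides with [dev a] and use the snake identity. *)
Lemma cpq_coev_comm :
  csig (cpq_tenso A cpq_dual) ∘ (dcoev a ⊗ P)
  = (P ⊗ dcoev a) ∘ csig (cpq_unit PQ).
Proof.
rewrite /= /cpq_sig /=.
have [ds cs] := csig_hom A; have [dt ct] := csig_inv_hom.
have [_ [_ st]] := invP (csig_iso A); have E := dual_sig_ev.
have [dS cS] := dual_sig_hom; move: dual_sig dS cS E => S dS cS E.
have [[de ce] [dco cco] snake _] := dualityP a.
apply: (@cancel_ev C X a P (P ⊗ X)) => /=; [solve_hom|solve_hom|].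
have e0 := slideE s (dev a).
have e1 := f_equal (tensm (idm X)) E.
have e2 := slideE (dcoev a) t.
have e3 := f_equal (fun m => m ⊗ P) snake.
have e4 := f_equal (tensm (idm P)) snake.
move: e0 e1 e2 e3 e4; expand; dc; ms => e0 e1 e2 e3 e4; cl.
rewrite -e0 (reassoc e1); try solve [dc].
rewrite -(reassoc e2); try solve [dc].
rewrite (reassoc_id (eq_trans e3 (tens_id _ _))); try solve [dc].
by rewrite e4 st cs !tens_id (compIl (hom_id _)).
Qed.
End DualObject.

(** The dualities for P and Q are used once each: the inner mate takes Q as dual
    of P, the outer one P as dual of Q. *)
Lemma double_dual_sig (A : cpq_ob PQ) (a : duality (cob A)) (a' : duality (dobj a)) :
  csig (cpq_dual (A := cpq_dual a) a')
  = mate (dual_tens a' pair_dualQ) (dual_tens pair_dualQ a')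
      (mate (dual_tens a pair_dualP) (dual_tens pair_dualP a) (csig A)).
Proof. by rewrite /= /dual_sig /= inv_dual_sig ubar_dual_sig_inv. Qed.

(** * Transport along isomorphisms and intertwiners *)

Section Transport.
Variables (A : cpq_ob PQ) (Y : Ob C) (th th' : Mor C).
Hypotheses (hth : hom Y (cob A) th) (thP : is_inverse th th').
Local Notation X := (cob A).
Local Notation s := (csig A).
Local Notation t := (inv (csig A)).

Definition transport_sig : Mor C := (P ⊗ th') ∘ s ∘ (th ⊗ P).
Definition transport_sig_inv : Mor C := (th' ⊗ P) ∘ t ∘ (P ⊗ th).

Lemma transport_sig_hom : hom (Y ⊗ P) (P ⊗ Y) transport_sig.
Proof.
have [? ?] := hth; have [? ?] := inverse_hom hth thP; have [? ?] := csig_hom A.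
rewrite /transport_sig; solve_hom.
Qed.

Lemma transport_sigP : is_inverse transport_sig transport_sig_inv.
Proof.
have [? ?] := hth; have [? ?] := inverse_hom hth thP; have [? ?] := csig_hom A.
have [? ?] := csig_inv_hom A.
rewrite /transport_sig /transport_sig_inv.
rewrite -(@comp_assoc C (th' ⊗ P) t (P ⊗ th)); [dc|dc|].
apply: (inverse_comp (X := (Y ⊗ P)%ob) (Y := (X ⊗ P)%ob) (Z := (P ⊗ Y)%ob)).
- solve_hom.
- solve_hom.
- exact: inverse_tens thP (inverse_id _).
- apply: (inverse_comp (X := (X ⊗ P)%ob) (Y := (P ⊗ X)%ob) (Z := (P ⊗ Y)%ob)).
  + solve_hom.
  + solve_hom.
  + exact: invP (csig_iso A).
  + exact: inverse_tens (inverse_id _) (is_inverse_sym thP).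
Qed.

(** [bar] and [ubar] are natural, so their being inverse is also transported. *)
Lemma transport_bar :
  bar PQ Y transport_sig = (th' ⊗ Q) ∘ bar PQ X s ∘ (Q ⊗ th).
Proof.
have [? ?] := hth; have [? ?] := inverse_hom hth thP; have [? ?] := csig_hom A.
case: (pp_left PQ) => [[de ce] [dco cco] _ _].
rewrite /transport_sig /bar.
have e1 := slideE ev (th' ⊗ Q); have e2 := slideE th coev.
have e3 := f_equal (tensm (idm Q)) e2.
move: e1 e3; expand; dc; ms => e1 e3; cl.
rewrite e1 -!comp_assoc; try solve [dc].
by rewrite e3.
Qed.

Lemma transport_ubar :
  ubar PQ Y transport_sig_inv = (Q ⊗ th') ∘ ubar PQ X t ∘ (th ⊗ Q).
Proof.
have [? ?] := hth; have [? ?] := inverse_hom hth thP; have [? ?] := csig_inv_hom A.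
case: (pp_right PQ) => [[de ce] [dco cco] _ _].
rewrite /transport_sig_inv /ubar.
have e1 := slideE (Q ⊗ th') uev; have e2 := slideE ucoev (th ⊗ Q).
move: e1 e2; expand; dc; ms => e1 e2; cl.
rewrite -e1 -!comp_assoc; try solve [dc].
by rewrite e2.
Qed.

Lemma transport_sig_bar :
  is_inverse (bar PQ Y transport_sig) (ubar PQ Y (inv transport_sig)).
Proof.
rewrite (inv_eq transport_sigP) transport_bar transport_ubar.
have [? ?] := hth; have [? ?] := inverse_hom hth thP.
have [? ?] := bar_hom PQ (csig_hom A); have [? ?] := ubar_hom PQ (csig_inv_hom A).
rewrite -(@comp_assoc C (Q ⊗ th')); [dc|dc|].
rewrite -(@comp_assoc C (th' ⊗ Q)); [dc|dc|].
rewrite (@comp_assoc C (th' ⊗ Q)); [dc|dc|].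
rewrite (@comp_assoc C (Q ⊗ th')); [dc|dc|].
rewrite -(@comp_assoc C (Q ⊗ th')); [dc|dc|].
apply: (inverse_comp (X := (Q ⊗ Y)%ob) (Y := (Q ⊗ X)%ob) (Z := (Y ⊗ Q)%ob)).
- solve_hom.
- solve_hom.
- exact: inverse_tens (inverse_id _) thP.
- apply: (inverse_comp (X := (Q ⊗ X)%ob) (Y := (X ⊗ Q)%ob) (Z := (Y ⊗ Q)%ob)).
  + solve_hom.
  + solve_hom.
  + exact: csig_bar.
  + exact: inverse_tens (is_inverse_sym thP) (inverse_id _).
Qed.

Definition cpq_transport : cpq_ob PQ :=
  CpqOb transport_sig_hom (ex_intro _ _ transport_sigP) transport_sig_bar.
End Transport.

(** The condition for [f] to underlie a morphism of C(P,Q), as a property of [f],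
    so that it can be established for a given morphism such as a chosen
    evaluation by rewriting it as a composite. *)
Definition intertwines (A B : cpq_ob PQ) (f : Mor C) : Prop :=
  hom (cob A) (cob B) f /\ csig B ∘ (f ⊗ P) = (P ⊗ f) ∘ csig A.

Definition cpq_lift A B f (i : intertwines A B f) : cpq_mor PQ :=
  CpqMor (proj1 i) (proj2 i).

Lemma intertwines_comp A B E f g :
  intertwines A B f -> intertwines B E g -> intertwines A E (g ∘ f).
Proof.
move=> i j; split; first exact: hom_comp (proj1 i) (proj1 j).
exact: (@cpq_comp_comm _ _ _ PQ (cpq_lift j) (cpq_lift i) eq_refl).
Qed.

Lemma intertwines_tens A B A' B' f g :
  intertwines A B f -> intertwines A' B' g ->
  intertwines (cpq_tenso A A') (cpq_tenso B B') (f ⊗ g).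
Proof.
move=> i j; split; first exact: hom_tens (proj1 i) (proj1 j).
exact: (@cpq_tensm_comm _ _ _ PQ (cpq_lift i) (cpq_lift j)).
Qed.

Lemma intertwines_inv A B f g :
  intertwines A B f -> is_inverse f g -> intertwines B A g.
Proof.
move=> [hf E] fg; have hg := inverse_hom hf fg; split=> //.
have [df cf] := hf; have [dg cg] := hg.
have [_ [gf fg1]] := fg; rewrite df in gf; rewrite cf in fg1.
have [? ?] := csig_hom A; have [? ?] := csig_hom B.
have e := f_equal (fun m => (P ⊗ g) ∘ m ∘ (g ⊗ P)) E.
have e1 := f_equal (fun m => m ⊗ P) fg1.
have e2 := f_equal (tensm (idm P)) gf.
move: e e1 e2; expand; dc; cl => e e1 e2.
move: e; rewrite e2 -!comp_assoc; try solve [dc].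
rewrite e1 !tens_id; have h : hom (cob B ⊗ P) (P ⊗ cob A) ((P ⊗ g) ∘ csig B) by solve_hom.
move=> e.
have h' : hom (cob B ⊗ P) (P ⊗ cob A) (csig A ∘ (g ⊗ P)) by solve_hom.
rewrite (compIl h') (compIr (csig_hom B)) in e.
by rewrite e.
Qed.

Lemma intertwines_transport A Y th th' (hth : hom Y (cob A) th)
  (thP : is_inverse th th') : intertwines (cpq_transport hth thP) A th.
Proof.
split=> //=; rewrite /transport_sig.
have [? ?] := hth; have [? ?] := inverse_hom hth thP; have [? ?] := csig_hom A.
have [_ [_ e]] := thP.
have e1 := f_equal (tensm (idm P)) e.
move: e1; expand; dc => e1; cl; rewrite e1 tens_id.
by rewrite (compIl (csig_hom A)).
Qed.

Lemma intertwines_dev A (a : duality (cob A)) :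
  intertwines (cpq_tenso (cpq_dual a) A) (cpq_unit PQ) (dev a).
Proof. by split; [case: (dualityP a)|exact: cpq_ev_comm]. Qed.

Lemma intertwines_dcoev A (a : duality (cob A)) :
  intertwines (cpq_unit PQ) (cpq_tenso A (cpq_dual a)) (dcoev a).
Proof. by split; [case: (dualityP a)|exact: cpq_coev_comm]. Qed.

End Pair.

(** * Comparison of right duals *)

Section RightDuals.
Variable C : monoidal.
Implicit Types X R : Ob C.

Lemma right_left_dual X R e c : is_right_dual X R e c <-> @is_left_dual C R X e c.
Proof. by split; case. Qed.

(** A left dual may be replaced by an isomorphic object; with the pivotal
    isomorphism from [X] to vvX this makes vX a right dual of [X]. *)
Lemma left_dual_along R X X' e c k k' : hom X X' k -> is_inverse k k' ->
  @is_left_dual C R X' e c ->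
  is_left_dual R X (e ∘ (k ⊗ R)) ((R ⊗ k') ∘ c).
Proof.
move=> hk kk' [[? ?] [? ?] s1 s2].
have [dk ck] := hk; have [? ?] := inverse_hom hk kk'.
have [_ [k'k kk]] := kk'; rewrite dk in k'k; rewrite ck in kk.
split; [solve_hom|solve_hom| |].
- have e1 := f_equal (fun m => R ⊗ m ⊗ R) kk.
  move: e1; expand; dc; ms; rewrite !tens_id => e1; cl.
  by rewrite (reassoc_id e1); try solve [dc].
- have e1 := slideE e k'; have e2 := slideE k (R ⊗ k'); have e3 := slideE k c.
  move: e1 e2 e3; expand; dc; ms => e1 e2 e3; cl.
  rewrite (reassoc e2); try solve [dc].
  rewrite e1 (reassoc e3); try solve [dc].
  rewrite -(@comp_assoc _ k'); [dc|dc|].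
  by rewrite s2 comp_id_dom ?k'k.
Qed.

(** If [X] is a left dual of both [R] and [R'], these are right duals of [X] and
    hence isomorphic.  Here [e] pairs [X] with [R], and [c'] is the coevaluation
    for [R']. *)
Definition left_dual_iso R R' (e c' : Mor C) : Mor C :=
  (R' ⊗ e) ∘ (c' ⊗ R).

Lemma left_dual_iso_hom R R' X e c e' c' :
  is_left_dual R X e c -> is_left_dual R' X e' c' ->
  hom R R' (left_dual_iso R R' e c').
Proof.
move=> [[? ?] [? ?] _ _] [[? ?] [? ?] _ _]; rewrite /left_dual_iso; solve_hom.
Qed.

Lemma left_dual_iso_ev R R' X e c e' c' :
  is_left_dual R X e c -> is_left_dual R' X e' c' ->
  e' ∘ (X ⊗ left_dual_iso R R' e c') = e.
Proof.
move=> [[? ?] [? ?] _ _] [[? ?] [? ?] _ s]; rewrite /left_dual_iso.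
have e1 := slideE e' e; have e2 := f_equal (fun m => m ⊗ R) s.
move: e1 e2; expand; dc; ms; rewrite !tens_id => e1 e2; cl.
rewrite e1 -comp_assoc; try solve [dc].
by rewrite e2 comp_id_dom; try solve [dc].
Qed.

Lemma left_dual_iso_inverse R R' X e c e' c' :
  is_left_dual R X e c -> is_left_dual R' X e' c' ->
  is_inverse (left_dual_iso R R' e c') (left_dual_iso R' R e' c).
Proof.
suff cancel S S' f d f' d' : is_left_dual S X f d -> is_left_dual S' X f' d' ->
    left_dual_iso S' S f' d ∘ left_dual_iso S S' f d' = S.
  move=> a b; have [dt ct] := left_dual_iso_hom a b.
  split; [|split]; rewrite ?dt ?ct; first exact: left_dual_iso_hom b a.
    exact: cancel a b.
  exact: cancel b a.
move=> a b; have ht := left_dual_iso_hom a b; have ht' := left_dual_iso_hom b a.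
apply: (@cancel_ev_left C S (Duality a) S 𝟏) => /=.
- by rewrite tenso1r; exact: hom_comp ht ht'.
- by rewrite tenso1r; exact: hom_id.
- have E := left_dual_iso_ev a b; have E' := left_dual_iso_ev b a.
  move: (left_dual_iso S S' f d') (left_dual_iso S' S f' d) ht ht' E E'
    => m n [? ?] [? ?] E E'.
  have [[? ?] _ _ _] := a; have [[? ?] _ _ _] := b.
  by expand; ms; cl; rewrite E' E tens_id comp_id_dom; try solve [dc].
Qed.

Lemma left_dual_iso_coev R R' X e c e' c' :
  is_left_dual R X e c -> is_left_dual R' X e' c' ->
  (left_dual_iso R R' e c' ⊗ X) ∘ c = c'.
Proof.
move=> [[? ?] [? ?] _ s] [[? ?] [? ?] _ _]; rewrite /left_dual_iso.
have e1 := slideE c' c; have e2 := f_equal (tensm (idm R')) s.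
move: e1 e2; expand; dc; ms; rewrite !tens_id => e1 e2; cl.
rewrite -comp_assoc; try solve [dc].
by rewrite e1; cl; rewrite e2 comp_id_cod.
Qed.
End RightDuals.

(** * The pivotal structure as an intertwiner *)

Section Pivotal.
Variables (C : monoidal) (D : rigid_structure C).

Definition chosen (X : Ob C) : duality X := Duality (ldP D X).

Lemma ldmE X Y f : hom X Y f -> ldm D f = mate (chosen X) (chosen Y) f.
Proof. by move=> [<- <-]. Qed.

(** The structure morphisms of the dual functor are mates of identities; this
    reduces [dd2] to the functoriality of mates. *)
Lemma ld2E X Y :
  ld2 D X Y = mate (chosen (X ⊗ Y)) (dual_tens (chosen X) (chosen Y)) (X ⊗ Y)%ob.
Proof.
rewrite /ld2 /mate /= !tens_id comp_id_dom //.
case: (ldP D X) (ldP D Y) => [[? ?] [? ?] _ _] [[? ?] [? ?] _ _]; dc.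
Qed.

Lemma ld2_inverse X Y :
  is_inverse (ld2 D X Y)
    (mate (dual_tens (chosen X) (chosen Y)) (chosen (X ⊗ Y)) (X ⊗ Y)%ob).
Proof. by rewrite ld2E; apply: mate_inverse (hom_id _) (inverse_id _). Qed.

Lemma ld2_hom X Y : hom (ld D Y ⊗ ld D X) (ld D (X ⊗ Y)) (ld2 D X Y).
Proof. by rewrite ld2E; exact: mate_hom (hom_id _). Qed.

Lemma inv_ld2_hom X Y : hom (ld D (X ⊗ Y)) (ld D Y ⊗ ld D X) (inv (ld2 D X Y)).
Proof.
apply: inverse_hom (ld2_hom X Y) _; apply: invP.
by eexists; exact: ld2_inverse.
Qed.

Lemma dd2E X Y :
  dd2 D X Y = mate (chosen (ld D (X ⊗ Y)))
    (dual_tens (chosen (ld D Y)) (chosen (ld D X))) (inv (ld2 D X Y)).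
Proof.
rewrite /dd2 [ld2 D (ld D Y) _]ld2E.
have e := mate_comp (chosen (ld D (X ⊗ Y))) (chosen (ld D Y ⊗ ld D X))
  (dual_tens (chosen (ld D Y)) (chosen (ld D X))) (inv_ld2_hom X Y) (hom_id _).
rewrite (compIl (inv_ld2_hom X Y)) in e.
by rewrite e (ldmE (inv_ld2_hom X Y)).
Qed.

Lemma dd2_hom X Y :
  hom (ld D (ld D X) ⊗ ld D (ld D Y)) (ld D (ld D (X ⊗ Y))) (dd2 D X Y).
Proof. by rewrite dd2E; exact: mate_hom (inv_ld2_hom X Y). Qed.

Lemma dd2_iso X Y : is_iso (dd2 D X Y).
Proof.
rewrite dd2E; exists (mate (dual_tens (chosen (ld D Y)) (chosen (ld D X)))
  (chosen (ld D (X ⊗ Y))) (ld2 D X Y)).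
apply: mate_inverse (inv_ld2_hom X Y) (is_inverse_sym (invP _)).
by eexists; exact: ld2_inverse.
Qed.

(** Both composites are mates of the same morphism, the mate of [f] going from
    v(Z ⊗ W) to vY ⊗ vX. *)
Lemma dd2_nat X Y Z W f : hom (X ⊗ Y) (Z ⊗ W) f ->
  ldm D (ldm D f) ∘ dd2 D X Y = dd2 D Z W ∘
    mate (dual_tens (chosen (ld D W)) (chosen (ld D Z)))
      (dual_tens (chosen (ld D Y)) (chosen (ld D X)))
      (mate (dual_tens (chosen X) (chosen Y)) (dual_tens (chosen Z) (chosen W)) f).
Proof.
move=> hf; rewrite (ldmE hf).
have hm := mate_hom (chosen (X ⊗ Y)) (chosen (Z ⊗ W)) hf.
have hm' := mate_hom (dual_tens (chosen X) (chosen Y)) (dual_tens (chosen Z) (chosen W)) hf.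
rewrite (ldmE hm).
rewrite !dd2E -(mate_comp _ _ _ hm (inv_ld2_hom X Y)) -(mate_comp _ _ _ (inv_ld2_hom Z W) hm').
congr (mate _ _ _).
rewrite (inv_eq (ld2_inverse X Y)) (inv_eq (ld2_inverse Z W)).
rewrite -(mate_comp _ _ _ (hom_id _) hf) -(mate_comp _ _ _ hf (hom_id _)).
by rewrite (compIr hf) (compIl hf).
Qed.

Lemma ld0_hom : hom 𝟏 (ld D 𝟏) (ld0 D).
Proof. by case: (ldP D 𝟏) => _ h _ _; rewrite tenso1l in h. Qed.

Lemma ld0_inverse : is_inverse (ld0 D) (ev D 𝟏).
Proof.
have [d c] := ld0_hom; rewrite /ld0 in d c *.
case: (ldP D 𝟏) => [[de ce] _ s1 s2]; rewrite tenso1r in de.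
rewrite tensm1l tensm1r in s1.
have e := slideE (ev D 𝟏) (coev D 𝟏).
rewrite de ce d c s2 tensm1l tensm1r in e.
by split; [|split]; rewrite ?d ?c.
Qed.

Lemma inv_ld0_hom : hom (ld D 𝟏) 𝟏 (inv (ld0 D)).
Proof. by rewrite (inv_eq ld0_inverse); exact: inverse_hom ld0_hom ld0_inverse. Qed.

Lemma ldm_hom X Y f : hom X Y f -> hom (ld D Y) (ld D X) (ldm D f).
Proof. by move=> hf; rewrite (ldmE hf); exact: mate_hom hf. Qed.

Variables (rho : pivotal_structure D) (P : Ob C) (PQ : pivotal_pair P (ld D P)).
Hypotheses (hfix : ld D (ld D P) = P) (hrho : piv rho P = idm P).
Hypotheses (chosen_P : chosen P = pair_dualP PQ) (chosen_Q : chosen (ld D P) = pair_dualQ PQ).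

Definition cpq_ld (A : cpq_ob PQ) : cpq_ob PQ := cpq_dual (chosen (cob A)).

(** By [double_dual_sig] and [dd2_nat] the half-braiding of the double dual is
    [ldm (ldm s)] up to [dd2], so composing the claim with the isomorphism [dd2]
    turns it into naturality of the pivotal structure at the half-braiding [s]
    of [A]; monoidality splits its components at [cob A ⊗ P] and [P ⊗ cob A], where
    the factor at P is trivial. *)
Lemma intertwines_piv A : intertwines A (cpq_ld (cpq_ld A)) (piv rho (cob A)).
Proof.
have hX : hom (cob A) (cob (cpq_ld (cpq_ld A))) (piv rho (cob A)) by exact: piv_hom.
split=> //.
have hs := csig_hom A; have hs2 := csig_hom (cpq_ld (cpq_ld A)).
have hd := dd2_hom P (cob A); rewrite hfix in hd.
have hd' := dd2_hom (cob A) P; rewrite hfix in hd'.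
have hl := hom_tens hX (hom_id P); have hr := hom_tens (hom_id P) hX.
apply: (is_iso_cancel (dd2_iso P (cob A)) hd (hom_comp hl hs2) (hom_comp hs hr)).
have nat := dd2_nat hs; have tL := piv_tens rho (cob A) P; have tR := piv_tens rho P (cob A).
have sq := piv_nat rho hs.
rewrite hrho in tL tR.
rewrite (compA hl hs2 hd) (compA hs hr hd) -tR sq tL.
have hss : hom (ld D (ld D (cob A ⊗ P))) (ld D (ld D (P ⊗ cob A)))
    (ldm D (ldm D (csig A))). by do 2!apply: ldm_hom.
by rewrite (compA hl hd' hss) nat double_dual_sig -chosen_P -chosen_Q.
Qed.
End Pivotal.

(** * Reflection along the forgetful functor *)

Section Faithful.
Variables (C : monoidal) (P Q : Ob C) (PQ : pivotal_pair P Q).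
Local Notation CPQ := (cpq PQ).

Lemma cpq_faithful (A B : Ob CPQ) (f g : Mor CPQ) :
  hom A B f -> hom A B g -> cmor f = cmor g -> f = g.
Proof. by move=> [<- <-] [dg cg] e; exact: cpq_mor_eq. Qed.

Lemma cmor_comp (g f : Mor CPQ) : dom g = cod f -> cmor (g ∘ f) = cmor g ∘ cmor f.
Proof. exact: (Fcomp (forgetful PQ)). Qed.

Lemma cpq_left_dual (A B : Ob CPQ) (e c : Mor CPQ) :
  hom (B ⊗ A) 𝟏 e -> hom 𝟏 (A ⊗ B) c ->
  is_left_dual (cob A) (cob B) (cmor e) (cmor c) -> is_left_dual A B e c.
Proof.
move=> he hc [_ _ s1 s2]; have [? ?] := he; have [? ?] := hc.
split=> //.
- apply: (cpq_faithful (A := A) (B := A)); [solve_hom|exact: hom_id|].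
  by rewrite cmor_comp; [dc|apply: s1].
- apply: (cpq_faithful (A := B) (B := B)); [solve_hom|exact: hom_id|].
  by rewrite cmor_comp; [dc|apply: s2].
Qed.

Lemma cpq_iso (f : Mor CPQ) : is_iso (cmor f) -> is_iso f.
Proof.
move=> [g fg]; have i : intertwines (csrc f) (ctgt f) (cmor f).
  by split; [exact: cmor_hom|exact: cmor_comm].
have j := intertwines_inv i fg; exists (cpq_lift j).
have hf : @hom CPQ (csrc f) (ctgt f) f by [].
have hg : @hom CPQ (ctgt f) (csrc f) (cpq_lift j) by [].
have [_ [e1 e2]] := fg; have [d c] := cmor_hom f; rewrite d in e1; rewrite c in e2.
split; [by []|split].
- apply: (cpq_faithful (hom_comp hf hg) (hom_id _)).
  by rewrite cmor_comp.
- apply: (cpq_faithful (hom_comp hg hf) (hom_id _)).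
  by rewrite cmor_comp.
Qed.

Lemma cmor_inv (f : Mor CPQ) : is_iso f -> cmor (inv f) = inv (cmor f).
Proof.
move=> fi; have [h [e1 e2]] := invP fi; symmetry; apply: inv_eq.
have [d c] := h; have [df cf] := hom_self f.
have [? ?] := cmor_hom f; have [? ?] := cmor_hom (inv f).
have E1 := f_equal (@cmor _ _ _ PQ) e1; have E2 := f_equal (@cmor _ _ _ PQ) e2.
rewrite cmor_comp in E1; first by [].
rewrite cmor_comp in E2; first by [].
split; [|split].
- by have := cmor_hom (inv f); move: d c => /= -> ->; have [-> ->] := cmor_hom f.
- by rewrite E1; have [-> _] := cmor_hom f.
- by rewrite E2; have [_ ->] := cmor_hom f.
Qed.

Section Lifts.
Variables (D : rigid_structure C) (D' : rigid_structure CPQ).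
Hypothesis L : lifts_duals D D'.

Lemma cob_ld A : cob (ld D' A) = ld D (cob A).
Proof. by have [[]] := L A. Qed.

Lemma cmor_ev A : cmor (ev D' A) = ev D (cob A).
Proof. by have [[]] := L A. Qed.

Lemma cmor_coev A : cmor (coev D' A) = coev D (cob A).
Proof. by have [[]] := L A. Qed.

Lemma cmor_ldm f : cmor (ldm D' f) = ldm D (cmor f).
Proof.
rewrite /ldm; have [? ?] := hom_self f.
have [[? ?] [? ?] _ _] := ldP D' (dom f).
have [[? ?] [? ?] _ _] := ldP D' (cod f).
have [-> ->] := cmor_hom f.
rewrite !cmor_comp; try solve [dc].
by rewrite /= !cmor_ev !cmor_coev !cob_ld.
Qed.

Lemma cmor_ld2 A B : cmor (ld2 D' A B) = ld2 D (cob A) (cob B).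
Proof.
rewrite /ld2.
have [[? ?] [? ?] _ _] := ldP D' A.
have [[? ?] [? ?] _ _] := ldP D' B.
have [[? ?] [? ?] _ _] := ldP D' (A ⊗ B)%ob.
rewrite cmor_comp; first dc.
rewrite /= cmor_comp; first dc.
by rewrite /= !cmor_ev !cmor_coev !cob_ld.
Qed.

Lemma cmor_dd2 A B : cmor (dd2 D' A B) = dd2 D (cob A) (cob B).
Proof.
have i : is_iso (ld2 D' A B) by eexists; exact: ld2_inverse.
have [? ?] := mate_hom (chosen D' _) (chosen D' _) (inv_ld2_hom D' A B).
have [? ?] := ld2_hom D' (ld D' B) (ld D' A).
rewrite /dd2 cmor_comp; first by rewrite (ldmE D' (inv_ld2_hom D' A B)); dc.
by rewrite cmor_ldm cmor_inv // !cmor_ld2 !cob_ld.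
Qed.

Lemma cmor_dd0 : cmor (dd0 D') = dd0 D.
Proof.
have i : is_iso (ld0 D') by eexists; exact: ld0_inverse.
have [_ c] := ld0_hom D'; have [d _] := ldm_hom D' (inv_ld0_hom D').
rewrite /dd0 cmor_comp; first by rewrite d.
by rewrite cmor_ldm cmor_inv // [cmor (ld0 D')]cmor_coev.
Qed.

End Lifts.
End Faithful.

(** * Rigidity and pivotality of the category C(P,Q) *)

Section CpqPivotal.
Variables (C : monoidal) (D : rigid_structure C) (rho : pivotal_structure D)
  (P : Ob C) (PQ : pivotal_pair P (ld D P)).
Hypotheses (hfix : ld D (ld D P) = P) (hrho : piv rho P = idm P).
Hypotheses (chosen_P : chosen D P = pair_dualP PQ) (chosen_Q : chosen D (ld D P) = pair_dualQ PQ).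
Local Notation CPQ := (cpq PQ).
Local Notation pivI := (intertwines_piv hfix hrho chosen_P chosen_Q).
Local Notation cpq_ld := (@cpq_ld C D P PQ).

Lemma intertwines_id A : @intertwines _ _ _ PQ A A (cob A).
Proof. by split; [exact: hom_id|exact: cpq_idm_comm]. Qed.

Section RightDual.
Variable A : cpq_ob PQ.
Local Notation X := (cob A).

Lemma rd_left_dual : is_left_dual (rd D X) X (ev_r D X) (coev_r D X).
Proof. exact: (proj1 (right_left_dual _ _ _ _) (rdP D X)). Qed.

Lemma piv_left_dual : is_left_dual (ld D X) X
  (ev D (ld D X) ∘ (piv rho X ⊗ ld D X))
  ((ld D X ⊗ inv (piv rho X)) ∘ coev D (ld D X)).
Proof. exact: left_dual_along (piv_hom rho X) (invP (piv_iso rho X)) (ldP D _). Qed.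

Definition cpq_rd : cpq_ob PQ := cpq_transport (A := cpq_ld A)
  (left_dual_iso_hom rd_left_dual piv_left_dual)
  (left_dual_iso_inverse rd_left_dual piv_left_dual).

(** The chosen evaluation is the one of [piv_left_dual] after the comparison
    isomorphism, hence a composite of intertwiners. *)
Lemma intertwines_ev_r : intertwines (cpq_tenso A cpq_rd) (cpq_unit PQ) (ev_r D X).
Proof.
have it := intertwines_transport (A := cpq_ld A)
  (left_dual_iso_hom rd_left_dual piv_left_dual)
  (left_dual_iso_inverse rd_left_dual piv_left_dual).
rewrite -(left_dual_iso_ev rd_left_dual piv_left_dual).
apply: intertwines_comp (intertwines_tens (intertwines_id A) it) _.
apply: intertwines_comp (intertwines_tens (pivI A) (intertwines_id _)) _.
exact: intertwines_dev.
Qed.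

Lemma intertwines_coev_r : intertwines (cpq_unit PQ) (cpq_tenso cpq_rd A) (coev_r D X).
Proof.
have it := intertwines_transport (A := cpq_ld A)
  (left_dual_iso_hom rd_left_dual piv_left_dual)
  (left_dual_iso_inverse rd_left_dual piv_left_dual).
have it' := intertwines_inv it (left_dual_iso_inverse rd_left_dual piv_left_dual).
have ip := intertwines_inv (pivI A) (invP (piv_iso rho X)).
rewrite -(left_dual_iso_coev piv_left_dual rd_left_dual).
apply: intertwines_comp (intertwines_tens it' (intertwines_id A)).
apply: intertwines_comp (intertwines_tens (intertwines_id _) ip).
exact: intertwines_dcoev.
Qed.
End RightDual.

Definition cpq_rigid : rigid_structure CPQ.
Proof.
refine (@RigidStructure CPQ cpq_ld
  (fun A => cpq_lift (intertwines_dev (chosen D (cob A))))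
  (fun A => cpq_lift (intertwines_dcoev (chosen D (cob A)))) _
  cpq_rd
  (fun A => cpq_lift (intertwines_ev_r A))
  (fun A => cpq_lift (intertwines_coev_r A)) _) => A.
- by apply: cpq_left_dual => //; exact: ldP.
- by apply/right_left_dual; apply: cpq_left_dual => //; exact: rd_left_dual.
Defined.

Lemma cpq_rigid_lifts : lifts_duals D cpq_rigid.
Proof. by move=> A. Qed.

Definition cpq_pivotal : pivotal_structure cpq_rigid.
Proof.
refine (@PivotalStructure CPQ cpq_rigid (fun A => cpq_lift (pivI A)) _ _ _ _ _).
- by [].
- by move=> A; apply: cpq_iso; exact: piv_iso.
- move=> A B f hf.
  have hA : @hom CPQ A (cpq_ld (cpq_ld A)) (cpq_lift (pivI A)) by [].
  have hB : @hom CPQ B (cpq_ld (cpq_ld B)) (cpq_lift (pivI B)) by [].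
  have hff : @hom CPQ (cpq_ld (cpq_ld A)) (cpq_ld (cpq_ld B))
    (ldm cpq_rigid (ldm cpq_rigid f)).
    exact: (ldm_hom cpq_rigid (ldm_hom cpq_rigid hf)).
  apply: (cpq_faithful (hom_comp hf hB) (hom_comp hA hff)).
  have [df cf] := hf.
  (* The instances are explicit because [cmor_comp] also matches [ldm] by
     unfolding it. *)
  rewrite (cmor_comp (f := f)); first by rewrite cf.
  rewrite (cmor_comp (f := cpq_lift (pivI A))); first by case: hff => ->.
  rewrite !(cmor_ldm cpq_rigid_lifts).
  apply: piv_nat; have := cmor_hom f.
  by move: df cf => /= -> ->.
- move=> A B; have hA : @hom CPQ A (cpq_ld (cpq_ld A)) (cpq_lift (pivI A)) by [].
  have hB : @hom CPQ B (cpq_ld (cpq_ld B)) (cpq_lift (pivI B)) by [].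
  have hd := dd2_hom cpq_rigid A B.
  apply: (cpq_faithful (A := A ⊗ B : Ob CPQ) _ (hom_comp (hom_tens hA hB) hd)) => //.
  rewrite cmor_comp ?(cmor_dd2 cpq_rigid_lifts); last exact: piv_tens.
  by case: hd => -> _.
- have hd : @hom CPQ (𝟏)%ob (ld cpq_rigid (ld cpq_rigid 𝟏)) (dd0 cpq_rigid).
    exact: hom_comp (ld0_hom cpq_rigid) (ldm_hom cpq_rigid (inv_ld0_hom cpq_rigid)).
  apply: cpq_faithful hd _ => //.
  by rewrite (cmor_dd0 cpq_rigid_lifts); exact: piv_unit.
Defined.

Lemma forgetful_preserves_pivotal : preserves_pivotal (forgetful PQ) cpq_pivotal rho.
Proof.
have zetaE (A : Ob CPQ) : zeta (forgetful PQ) cpq_rigid D A = idm (ld D (cob A)).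
  have [[? ?] [? ?] _ s] := ldP D (cob A).
  rewrite /zeta /= (inv_eq (inverse_id _)) comp_id_cod //.
  by rewrite comp_id_dom.
move=> A; rewrite !zetaE (inv_eq (inverse_id _)).
rewrite (ldmE D (hom_id _)) mate_id /=.
have [d c] := piv_hom rho (cob A).
by rewrite comp_id_cod ?dom_id ?cod_id // comp_id_cod.
Qed.
End CpqPivotal.

Theorem theorem4p5
    (C : monoidal) (D : rigid_structure C) (rho : pivotal_structure D)
    (P Q : Ob C) (PQ : pivotal_pair P Q)
    (hfix : ld D (ld D P) = P)
    (hdual : ld D P = Q)
    (hrho : piv rho P = idm P)
    (hev : pp_ev PQ = ev D P)
    (hcoev : pp_coev PQ = coev D P)
    (huev : pp_uev PQ = ev D Q)
    (hucoev : pp_ucoev PQ = coev D Q) :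
  exists (D' : rigid_structure (cpq PQ)) (rho' : pivotal_structure D'),
    lifts_duals D D' /\ preserves_pivotal (forgetful PQ) rho' rho.
Proof.
subst Q.
have chosen_P : chosen D P = pair_dualP PQ by exact: duality_eq.
have chosen_Q : chosen D (ld D P) = pair_dualQ PQ by exact: duality_eq.
exists (cpq_rigid hfix hrho chosen_P chosen_Q), (cpq_pivotal hfix hrho chosen_P chosen_Q); split.
- exact: cpq_rigid_lifts.
- exact: forgetful_preserves_pivotal.
Qed.
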